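(* Consider a linear-polyhedral multistage stochastic problem, with sets $X_t$, set-valued mappings $\mathcal U_t^w$, Bellman operators, value functions $V_t$ and constants $L_{V_t}$ as described in the context. Assume that the noises $\mathbf W_1,\dots,\mathbf W_T$ are independent with finite supports, that $X_t$ is nonempty and compact for every $t\in\{0,\dots,T\}$, and that $\mathcal U_t^w(x)$ is nonempty and compact for every $t\in\{0,\dots,T-1\}$, $w\in\mathrm{supp}(\mathbf W_{t+1})$ and $x\in X_t$. Then for every $t\in\{0,\dots,T\}$ the mapping $\underline S_t^{\mathrm{SDDP}}$ defined in the context is a selection function (for lower approximations), i.e.: - for $t=T$: $\underline S_T^{\mathrm{SDDP}}$ maps $X_T$ to $\underline{\mathbf F}_T^{\mathrm{SDDP}}$ and, for every $x\in X_T$, $\underline S_T^{\mathrm{SDDP}}(x)(x)=V_T(x)$ (tightness) and $\underline S_T^{\mathrm{SDDP}}(x)\le V_T$ (validity); - for $t<T$: $\underline S_t^{\mathrm{SDDP}}$ maps $\mathcal P(\underline{\mathbf F}_{t+1}^{\mathrm{SDDP}})\times X_t$ to $\underline{\mathbf F}_t^{\mathrm{SDDP}}$ and, for every set $F\subset\underline{\mathbf F}_{t+1}^{\mathrm{SDDP}}$ and every $x\in X_t$, $\underline S_t^{\mathrm{SDDP}}(F,x)(x)=\mathfrak B_t(\underline{\mathcal V}_F)(x)$ (tightness) and $\underline S_t^{\mathrm{SDDP}}(F,x)\le\mathfrak B_t(\underline{\mathcal V}_F)$ (validity), where $\underline{\mathcal V}_F=\sup_{\phi\in F}\phi$ pointw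ise.
   Context: $T\ge1$, $\mathbb X=\mathbb R^n$, $\mathbb U=\mathbb R^m$ with Euclidean norms, $\overline{\mathbb R}=\mathbb R\cup\{\pm\infty\}$; $\mathcal P(Z)$ is the power set of $Z$. $\mathbf W_t$ ($t=1,\dots,T$) is a random variable with finite support $\mathrm{supp}(\mathbf W_t)=\{w:\mathbb P(\mathbf W_t=w)>0\}$; for $w\in\mathrm{supp}(\mathbf W_{t+1})$ write $p_w=\mathbb P(\mathbf W_{t+1}=w)$. Linear-polyhedral problem: for $t\in\{0,\dots,T-1\}$ and $w\in\mathrm{supp}(\mathbf W_{t+1})$, the dynamics are $f_t^w(x,u)=A_t^wx+B_t^wu$ for matrices $A_t^w,B_t^w$ of suitable dimensions, and the cost is $$c_t^w(x,u)=\max_{i\in I_t}\big(\langle c_t^{i,w},(x;u)\rangle+d_t^{i,w}\big)+\delta_{P_t^w}(x,u),$$ where $I_t$ is a finite set, $c_t^{i,w}\in\mathbb X\times\mathbb U$, $d_t^{i,w}\in\mathbb R$, $P_t^w\subset\mathbb X\times\mathbb U$ is a convex polyhedron, and $\delta_A$ is $0$ on $A$ and $+\infty$ elsewhere. The final cost is $\psi(x)=\max_{i\in I_T}(\langle c_T^i,x\rangle+d_T^i)+\delta_{X_T}(x)$ with $I_T$ finite and $X_T$ a nonempty convex polytope. $\mathrm{dom}\,g=\{g<+\infty\}$. For $t<T$, $X_t=\bigcap_{w\in\mathrm{supp}(\mathbf W_{t+1})}\pi_{\mathbb X}(\mathrm{dom}\,c_t^w)$ with $\pi_{\mathbb X}(x,u)=x$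 (and $X_T=\mathrm{dom}\,\psi$), and $\mathcal U_t^w(x)=\{u\in\mathbb U:c_t^w(x,u)<+\infty\text{ and }f_t^w(x,u)\in X_{t+1}\}$. For such problems $f_t^w$ and $c_t^w$ are Lipschitz on $\mathrm{dom}\,c_t^w$ and $\mathcal U_t^w$ is Lipschitz on $X_t$ for the Hausdorff distance. For $\phi:\mathbb X\to\overline{\mathbb R}$: $\mathcal B_t^w(\phi)(x)=\min_{u\in\mathbb U}\big(c_t^w(x,u)+\phi(f_t^w(x,u))\big)$ and $\mathfrak B_t(\phi)(x)=\sum_{w\in\mathrm{supp}(\mathbf W_{t+1})}p_w\,\mathcal B_t^w(\phi)(x)$. Value functions: $V_T=\psi$, $V_t=\mathfrak B_t(V_{t+1})$ for $t<T$. The constants $L_{V_t}>0$ depend only on the problem data and are obtained by backward recursion: $L_{V_T}$ is a Lipschitz constant of $\psi$ on $X_T$, and $L_{V_t}$ is the constant, depending only on the data and on $L_{V_{t+1}}$, given by the fact that $\mathfrak B_t$ sends functions that are $L_{V_{t+1}}$-Lipschitz on $X_{t+1}$ to functions that are $L_{V_t}$-Lipschitz on $X_t$; in particular $V_t$ is $L_{V_t}$-Lipschitz on $X_t$. Basic functions: $\underline{\mathbf F}_t^{\mathrm{SDDP}}=\{\langle a,\cdot\rangle+b+\delta_{X_t}:(a,b)\in\mathbb X\times\mathbb R,\ \|a\|\le L_{V_t}\}$. The mapping at $t=T$: for $x\in X_T$, $\underline S_T^{\mathrm{SDDP}}(x)=\langle a_x,\cdot-x\rangle+b_x+\delta_{X_T}$,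 where $a_x$ is a subgradient of the convex polyhedral function $\psi$ at $x$ and $b_x=\psi(x)$. The mapping for $t<T$: given a set $F\subset\underline{\mathbf F}_{t+1}^{\mathrm{SDDP}}$ and $x\in X_t$, for each $w\in\mathrm{supp}(\mathbf W_{t+1})$ compute $b^w=\mathcal B_t^w(\underline{\mathcal V}_F)(x)$ and a subgradient $a^w$ of $\mathcal B_t^w(\underline{\mathcal V}_F)$ at $x$; then $\underline S_t^{\mathrm{SDDP}}(F,x)=\langle a,\cdot-x\rangle+b+\delta_{X_t}$ with $a=\sum_wp_wa^w$ and $b=\sum_wp_wb^w$.
   Formalization: F is taken nonempty with V_F finite somewhere on X_{t+1} (else no real intercept); any choice of subgradients gives tightness and validity, with values in F_t at interior points of X_t; on the boundary membership in F_t holds for a suitable choice of subgradients, as it fails for arbitrary ones. *)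

(* Defs.v *)
From HB Require Import structures.
From mathcomp Require Import all_boot all_order all_algebra.
From mathcomp Require Import all_classical all_reals all_analysis.

Set Implicit Arguments.
Unset Strict Implicit.
Unset Printing Implicit Defensive.

Import Order.TTheory GRing.Theory Num.Theory.
Import numFieldNormedType.Exports.

Local Open Scope classical_set_scope.
Local Open Scope ring_scope.

Definition dotv (R : realType) (n : nat) (a x : 'cV[R]_n) : R :=
  \sum_(i < n) a i 0 * x i 0.

(* The norm [`|x|] of the library on matrices is the sup norm. *)
Definition enorm (R : realType) (n : nat) (x : 'cV[R]_n) : R :=
  Num.sqrt (dotv x x).

Definition delta (R : realType) (V : Type) (A : set V) (x : V) : \bar R :=
  if `[< A x >] then 0%E else +oo%E.

Definition edom (R : realType) (V : Type) (g : V -> \bar R) : set V :=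
  [set x | (g x < +oo)%E].

Definition polyhedron (R : realType) (q : nat) (A : set 'cV[R]_q) : Prop :=
  exists (k : nat) (G : 'M[R]_(k, q)) (h : 'cV[R]_k),
    A = [set z | forall i, (G *m z) i 0 <= h i 0].

Definition polytope (R : realType) (q : nat) (A : set 'cV[R]_q) : Prop :=
  polyhedron A /\ exists M : R, forall z, A z -> enorm z <= M.

Definition lipschitz_on (R : realType) (n : nat) (L : R) (A : set 'cV[R]_n)
    (g : 'cV[R]_n -> \bar R) : Prop :=
  (forall x, A x -> g x \is a fin_num) /\
  (forall x y, A x -> A y -> (`|g x - g y| <= (L * enorm (x - y))%:E)%E).

Definition subgradient (R : realType) (n : nat) (g : 'cV[R]_n -> \bar R)
    (x a : 'cV[R]_n) : Prop :=
  g x \is a fin_num /\ forall y, (g x + (dotv a (y - x))%:E <= g y)%E.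

Definition noise_supp d (Omega : measurableType d) (R : realType)
    (Pr : probability Omega R) dW (TW : measurableType dW)
    (Z : {RV Pr >-> TW}) : set TW :=
  [set w | (0 < Pr (Z @^-1` [set w]))%E].

Definition noise_prob d (Omega : measurableType d) (R : realType)
    (Pr : probability Omega R) dW (TW : measurableType dW)
    (Z : {RV Pr >-> TW}) (w : TW) : R :=
  fine (Pr (Z @^-1` [set w])).

Definition finitely_supported d (Omega : measurableType d) (R : realType)
    (Pr : probability Omega R) dW (TW : measurableType dW)
    (Z : {RV Pr >-> TW}) : Prop :=
  finite_set (noise_supp Z) /\ Pr (Z @^-1` noise_supp Z) = 1%E.

Definition independent_noises d (Omega : measurableType d) (R : realType)
    (Pr : probability Omega R) dW (TW : measurableType dW) (T : nat)
    (W : nat -> {RV Pr >-> TW}) : Prop :=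
  forall (J : {set 'I_T}) (B : 'I_T -> set TW),
    (forall j, measurable (B j)) ->
    Pr (\bigcap_(j in [set` J]) (W j.+1 @^-1` B j)) =
    (\prod_(j in J) Pr (W j.+1 @^-1` B j))%E.

(* Only [lp_W t] for 1 <= t <= lp_T is meaningful, and, for the stage data,
   only the stages t < lp_T and the values w in the support of [lp_W t.+1]. *)
Record lp_problem (R : realType) d (Omega : measurableType d)
    (Pr : probability Omega R) dW (TW : measurableType dW) (n m : nat) :=
  LPProblem {
    lp_T : nat;
    lp_W : nat -> {RV Pr >-> TW};
    lp_A : nat -> TW -> 'M[R]_(n, n);
    lp_B : nat -> TW -> 'M[R]_(n, m);
    lp_I : nat -> finType;
    lp_c : forall t, lp_I t -> TW -> 'cV[R]_(n + m);
    lp_d : forall t, lp_I t -> TW -> R;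
    lp_P : nat -> TW -> set 'cV[R]_(n + m);
    lp_cT : lp_I lp_T -> 'cV[R]_n;
    lp_dT : lp_I lp_T -> R;
    lp_XT : set 'cV[R]_n
  }.

Section LinearPolyhedral.
Context (R : realType) d (Omega : measurableType d) (Pr : probability Omega R)
  dW (TW : measurableType dW) (n m : nat) (Q : lp_problem Pr TW n m).

Local Notation T := (lp_T Q).
Implicit Types (t : nat) (w : TW) (x y : 'cV[R]_n) (u : 'cV[R]_m)
  (phi g : 'cV[R]_n -> \bar R) (F : set ('cV[R]_n -> \bar R)) (L : nat -> R).

(* [lp_supp t] and [lp_p t w] refer to the noise of index t + 1. *)
Definition lp_supp t : set TW := noise_supp (lp_W Q t.+1).
Definition lp_p t w : R := noise_prob (lp_W Q t.+1) w.

Definition dynamics t w x u : 'cV[R]_n := lp_A Q t w *m x + lp_B Q t w *m u.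

Definition cost t w x u : \bar R :=
  (\big[maxe/-oo]_(i : lp_I Q t)
      (dotv (lp_c i w) (col_mx x u) + lp_d i w)%:E
   + delta R (lp_P Q t w) (col_mx x u))%E.

Definition final_cost x : \bar R :=
  (\big[maxe/-oo]_(i : lp_I Q T) (dotv (lp_cT i) x + lp_dT i)%:E
   + delta R (lp_XT Q) x)%E.

Definition linear_polyhedral : Prop :=
  [/\ (1 <= T)%N,
      (forall t, (t <= T)%N -> (0 < #|lp_I Q t|)%N),
      (forall t w, (t < T)%N -> lp_supp t w -> polyhedron (lp_P Q t w)),
      lp_XT Q !=set0 & polytope (lp_XT Q)].

Definition stateX t : set 'cV[R]_n :=
  if (t < T)%N then
    [set x | forall w, lp_supp t w -> exists u, (cost t w x u < +oo)%E]
  else edom final_cost.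

Definition controlU t w x : set 'cV[R]_m :=
  [set u | (cost t w x u < +oo)%E /\ stateX t.+1 (dynamics t w x u)].

(* [%dE] is the addition of the extended reals with
   (+oo) + (-oo) = +oo, so that an infeasible pair (x, u) always costs +oo. *)
Definition bellman_w t w phi x : \bar R :=
  ereal_inf (range (fun u => (cost t w x u + phi (dynamics t w x u))%dE)).

Definition bellman t phi x : \bar R :=
  (\sum_(w \in lp_supp t) ((lp_p t w)%:E * bellman_w t w phi x)%E)%dE.

Fixpoint value_rev (k : nat) : 'cV[R]_n -> \bar R :=
  if k is k'.+1 then bellman (T - k'.+1)%N (value_rev k') else final_cost.

Definition value t : 'cV[R]_n -> \bar R := value_rev (T - t)%N.

(* The constant of stage t may be any positive real for which the Bellman
   operator propagates Lipschitz continuity; the functions it is applied to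
   live on [stateX t.+1], i.e. equal +oo elsewhere. *)
Definition lipschitz_constants L : Prop :=
  [/\ (forall t, (t <= T)%N -> 0 < L t),
      lipschitz_on (L T) (stateX T) final_cost
    & forall t phi, (t < T)%N ->
        (forall x, ~ stateX t.+1 x -> phi x = +oo%E) ->
        lipschitz_on (L t.+1) (stateX t.+1) phi ->
        lipschitz_on (L t) (stateX t) (bellman t phi)].

Definition basic L t : set ('cV[R]_n -> \bar R) :=
  [set g | exists (a : 'cV[R]_n) (b : R), enorm a <= L t /\
     g = fun y => ((dotv a y + b)%:E + delta R (stateX t) y)%E].

Definition sup_of F : 'cV[R]_n -> \bar R :=
  fun y => ereal_sup [set phi y | phi in F].

Definition cut t (a x : 'cV[R]_n) (b : R) : 'cV[R]_n -> \bar R :=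
  fun y => ((dotv a (y - x) + b)%:E + delta R (stateX t) y)%E.

Definition sddp_cutT x g : Prop :=
  exists (a : 'cV[R]_n) (b : R),
    [/\ subgradient final_cost x a, final_cost x = b%:E & g = cut T a x b].

Definition sddp_cut t F x g : Prop :=
  exists (a : TW -> 'cV[R]_n) (b : TW -> R),
    (forall w, lp_supp t w ->
       bellman_w t w (sup_of F) x = (b w)%:E /\
       subgradient (bellman_w t w (sup_of F)) x (a w)) /\
    g = cut t (\sum_(w \in lp_supp t) lp_p t w *: a w) x
              (\sum_(w \in lp_supp t) lp_p t w * b w).

(* Sets of basic functions whose supremum is finite somewhere on the next state
   set. For the others (the empty set, or an unbounded set of functions) the
   supremum is identically -oo or +oo and the cut has no real intercept. *)
Definition admissible L t F : Prop :=
  [/\ F `<=` basic L t.+1, F !=set0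
    & exists2 y, stateX t.+1 y & (sup_of F y < +oo)%E].

(* A mapping built with some choice of the subgradients. *)
Definition sddp_mapT (S : 'cV[R]_n -> 'cV[R]_n -> \bar R) : Prop :=
  forall x, stateX T x -> sddp_cutT x (S x).

Definition sddp_map L t
    (S : set ('cV[R]_n -> \bar R) -> 'cV[R]_n -> 'cV[R]_n -> \bar R) : Prop :=
  forall F x, admissible L t F -> stateX t x -> sddp_cut t F x (S F x).

Definition tight_validT (S : 'cV[R]_n -> 'cV[R]_n -> \bar R) : Prop :=
  forall x, stateX T x ->
    S x x = value T x /\ forall y, (S x y <= value T y)%E.

Definition tight_valid L t
    (S : set ('cV[R]_n -> \bar R) -> 'cV[R]_n -> 'cV[R]_n -> \bar R) : Prop :=
  forall F x, admissible L t F -> stateX t x ->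
    S F x x = bellman t (sup_of F) x /\
    forall y, (S F x y <= bellman t (sup_of F) y)%E.

Definition selectionT L (S : 'cV[R]_n -> 'cV[R]_n -> \bar R) : Prop :=
  (forall x, stateX T x -> basic L T (S x)) /\ tight_validT S.

Definition selection L t
    (S : set ('cV[R]_n -> \bar R) -> 'cV[R]_n -> 'cV[R]_n -> \bar R) : Prop :=
  (forall F x, admissible L t F -> stateX t x -> basic L t (S F x)) /\
  tight_valid L t S.

End LinearPolyhedral.

(* Main.v *)
Require Import Defs.
From HB Require Import structures.
From mathcomp Require Import all_boot all_order all_algebra.
From mathcomp Require Import all_classical all_reals all_analysis.
From mathcomp Require Import finmap ring lra.

Set Implicit Arguments.
Unset Strict Implicit.
Unset Printing Implicit Defensive.

Import Order.TTheory GRing.Theory Num.Theory.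
Import numFieldNormedType.Exports.
Import DualAddTheory.

Local Open Scope classical_set_scope.
Local Open Scope ring_scope.

(** Each function [bellman_w t w (sup_of F)] is convex and Lipschitz on the
    polyhedron of the states at which a control is available, and is +oo
    elsewhere; [stateX t] is the intersection of these polyhedra. The averaged
    function is [L t]-Lipschitz on [stateX t] and hence has, at each point of
    [stateX t], boundary points included, a subgradient of norm at most [L t].
    The subdifferential sum rule writes it as the average of subgradients of the
    functions [bellman_w t w (sup_of F)]. No relative interiors have to meet for
    this rule: polyhedra are linearly regular, which follows from the Lipschitz
    continuity of polyhedral set-valued maps. *)

Section Euclidean.
Context (R : realType).
Implicit Types (q r : nat).

Lemma dotvE q (a x : 'cV[R]_q) : dotv a x = (a^T *m x) 0 0.
Proof. by rewrite mxE; apply: eq_bigr => i _; rewrite mxE. Qed.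

Lemma dotvC q (a x : 'cV[R]_q) : dotv a x = dotv x a.
Proof. by apply: eq_bigr => i _; rewrite mulrC. Qed.

Lemma dotvDr q (a x y : 'cV[R]_q) : dotv a (x + y) = dotv a x + dotv a y.
Proof. by rewrite !dotvE mulmxDr mxE. Qed.

Lemma dotvZr q (a x : 'cV[R]_q) k : dotv a (k *: x) = k * dotv a x.
Proof. by rewrite !dotvE -scalemxAr mxE. Qed.

Lemma dotvNr q (a x : 'cV[R]_q) : dotv a (- x) = - dotv a x.
Proof. by rewrite !dotvE mulmxN mxE. Qed.

Lemma dotvBr q (a x y : 'cV[R]_q) : dotv a (x - y) = dotv a x - dotv a y.
Proof. by rewrite dotvDr dotvNr. Qed.

Lemma dotv0r q (a : 'cV[R]_q) : dotv a 0 = 0.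
Proof. by rewrite dotvE mulmx0 mxE. Qed.

Lemma dotvDl q (a b x : 'cV[R]_q) : dotv (a + b) x = dotv a x + dotv b x.
Proof. by rewrite !(dotvC _ x) dotvDr. Qed.

Lemma dotvZl q (a x : 'cV[R]_q) k : dotv (k *: a) x = k * dotv a x.
Proof. by rewrite !(dotvC _ x) dotvZr. Qed.

Lemma dotvBl q (a b x : 'cV[R]_q) : dotv (a - b) x = dotv a x - dotv b x.
Proof. by rewrite !(dotvC _ x) dotvBr. Qed.

Lemma dotv0l q (a : 'cV[R]_q) : dotv 0 a = 0.
Proof. by rewrite dotvC dotv0r. Qed.

Lemma dotv_suml q (I : Type) (s : seq I) (a : I -> 'cV[R]_q) x :
  dotv (\sum_(i <- s) a i) x = \sum_(i <- s) dotv (a i) x.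
Proof. by elim/big_rec2: _ => [|i y z _ <-]; rewrite ?dotv0l ?dotvDl. Qed.

Lemma dotv_col_mx q r (a y : 'cV[R]_q) (b u : 'cV[R]_r) :
  dotv (col_mx a b) (col_mx y u) = dotv a y + dotv b u.
Proof. by rewrite !dotvE tr_col_mx mul_row_col mxE. Qed.

Lemma dotv_trmx_mul q r (M : 'M[R]_(q, r)) a z :
  dotv (M^T *m a) z = dotv a (M *m z).
Proof. by rewrite !dotvE trmx_mul trmxK mulmxA. Qed.

Lemma mulmx_dotv q r (M : 'M[R]_(q, r)) z i : (M *m z) i 0 = dotv (row i M)^T z.
Proof. by rewrite mxE; apply: eq_bigr => j _; rewrite !mxE. Qed.

Lemma dotvv_ge0 q (x : 'cV[R]_q) : 0 <= dotv x x.
Proof. by apply: sumr_ge0 => i _; rewrite -expr2 sqr_ge0. Qed.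

Lemma enorm_ge0 q (x : 'cV[R]_q) : 0 <= enorm x.
Proof. exact: sqrtr_ge0. Qed.

Lemma sqr_enorm q (x : 'cV[R]_q) : enorm x ^+ 2 = dotv x x.
Proof. by rewrite sqr_sqrtr ?dotvv_ge0. Qed.

Lemma enorm0 q : enorm (0 : 'cV[R]_q) = 0.
Proof. by rewrite /enorm dotv0r sqrtr0. Qed.

Lemma enormZ q k (x : 'cV[R]_q) : enorm (k *: x) = `|k| * enorm x.
Proof.
by rewrite /enorm dotvZl dotvZr mulrA -expr2 sqrtrM ?sqr_ge0// sqrtr_sqr.
Qed.

Lemma enormN q (x : 'cV[R]_q) : enorm (- x) = enorm x.
Proof. by rewrite -scaleN1r enormZ normrN1 mul1r. Qed.

Lemma enorm_distC q (x y : 'cV[R]_q) : enorm (x - y) = enorm (y - x).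
Proof. by rewrite -enormN opprB. Qed.

Lemma enorm_col_mx0 q r (y : 'cV[R]_q) :
  enorm (col_mx y (0 : 'cV[R]_r)) = enorm y.
Proof. by rewrite /enorm dotv_col_mx dotv0r addr0. Qed.

Lemma enorm_col_0mx q r (u : 'cV[R]_r) :
  enorm (col_mx (0 : 'cV[R]_q) u) = enorm u.
Proof. by rewrite /enorm dotv_col_mx dotv0r add0r. Qed.

Lemma enorm_eq0 q (x : 'cV[R]_q) : enorm x = 0 -> x = 0.
Proof.
move=> /eqP; rewrite -sqrf_eq0 sqr_enorm psumr_eq0; last first.
  by move=> i _; rewrite -expr2 sqr_ge0.
move=> /allP x0.
apply/colP => i; have := x0 i; rewrite mem_index_enum => /(_ isT) /=.
by rewrite mulf_eq0 orbb mxE => /eqP.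
Qed.

Lemma cauchy_schwarz q (a x : 'cV[R]_q) : dotv a x <= enorm a * enorm x.
Proof.
have [/enorm_eq0 ->|x0] := eqVneq (enorm x) 0.
  by rewrite dotv0r mulr_ge0 ?enorm_ge0.
have [/enorm_eq0 ->|a0] := eqVneq (enorm a) 0.
  by rewrite dotv0l mulr_ge0 ?enorm_ge0.
have := dotvv_ge0 (enorm x *: a - enorm a *: x).
rewrite dotvBr !dotvBl !dotvZl !dotvZr -!sqr_enorm (dotvC x a).
set A := enorm a in a0 *; set X := enorm x in x0 *; set D := dotv a x.
rewrite (_ : _ - _ = 2 * (A * X) * (A * X - D)); last by ring.
by rewrite pmulr_rge0 ?subr_ge0// !mulr_gt0 // lt_def ?a0 ?x0 enorm_ge0.
Qed.

Lemma ler_dotv q (a x : 'cV[R]_q) L : enorm a <= L -> dotv a x <= L * enorm x.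
Proof.
move=> aL; apply: le_trans (cauchy_schwarz a x) _.
by rewrite ler_wpM2r ?enorm_ge0.
Qed.

Lemma enorm_le_of_dotv_le q (b : 'cV[R]_q) c K :
  0 <= K -> (forall h, dotv b h <= c + K * enorm h) -> enorm b <= K.
Proof.
move=> K0 bK; rewrite leNgt; apply/negP => Kb.
have c0 : 0 <= c by have := bK 0; rewrite dotv0r enorm0 mulr0 addr0.
have slope0 : 0 < enorm b * (enorm b - K).
  by rewrite mulr_gt0 ?subr_gt0// (le_lt_trans K0).
pose t := (c + 1) / (enorm b * (enorm b - K)).
have t0 : 0 <= t by rewrite divr_ge0 ?addr_ge0// ltW.
have := bK (t *: b); rewrite dotvZr -sqr_enorm enormZ ger0_norm//.
have : t * (enorm b * (enorm b - K)) = c + 1 by rewrite divfK// gt_eqF.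
by rewrite expr2; lra.
Qed.

Lemma ler_enormD q (x y : 'cV[R]_q) : enorm (x + y) <= enorm x + enorm y.
Proof.
rewrite -ler_sqr ?nnegrE ?addr_ge0 ?enorm_ge0//.
rewrite sqr_enorm dotvDr !dotvDl (dotvC y) sqrrD !sqr_enorm.
by have := cauchy_schwarz x y; lra.
Qed.

Lemma ler_enorm_col_mx q r (y : 'cV[R]_q) (u : 'cV[R]_r) :
  enorm (col_mx y u) <= enorm y + enorm u.
Proof.
have -> : col_mx y u = col_mx y 0 + col_mx 0 u.
  by rewrite add_col_mx addr0 add0r.
by apply: le_trans (ler_enormD _ _) _; rewrite enorm_col_mx0 enorm_col_0mx.
Qed.

Lemma ler_enorm_dist q (x y z : 'cV[R]_q) :
  enorm (x - z) <= enorm (x - y) + enorm (y - z).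
Proof. by rewrite -{1}(subrKA y) ler_enormD. Qed.

Lemma ler_term_sum (I : finType) (F : I -> R) i :
  (forall j, 0 <= F j) -> F i <= \sum_j F j.
Proof. by move=> F0; rewrite (bigD1 i)//= lerDl sumr_ge0. Qed.

Lemma enorm_le_sum q (x : 'cV[R]_q) : enorm x <= \sum_i `|x i 0|.
Proof.
rewrite -ler_sqr ?nnegrE ?enorm_ge0 ?sumr_ge0// sqr_enorm expr2 mulr_suml.
apply: ler_sum => i _; rewrite -expr2 -real_normK ?num_real// expr2.
by rewrite ler_wpM2l// (@ler_term_sum _ (fun i => `|x i 0|)).
Qed.

Lemma enorm_mulmx_bounded q r (M : 'M[R]_(q, r)) :
  exists2 k, 0 <= k & forall z, enorm (M *m z) <= k * enorm z.
Proof.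
exists (\sum_i enorm (row i M)^T) => [|z].
  by apply: sumr_ge0 => i _; exact: enorm_ge0.
apply: le_trans (enorm_le_sum _) _; rewrite mulr_suml; apply: ler_sum => i _.
by rewrite mulmx_dotv ler_norml lerNl -dotvNr -{1}(enormN z) !ler_dotv.
Qed.

Lemma compact_enorm_bounded q (A : set 'cV[R]_q) :
  compact A -> exists M, forall z, A z -> enorm z <= M.
Proof.
move=> /compact_bounded/pinfty_ex_gt0[M _ AM]; exists (\sum_(i < q) M) => z Az.
apply: le_trans (enorm_le_sum z) _; apply: ler_sum => i _.
by apply: le_trans (AM _ Az); rewrite [leRHS]mx_normrE (le_bigmax _ _ (i, 0)).
Qed.

End Euclidean.

Section Convexity.
Context (R : realType).

Lemma ler_conv (t a b c d : R) : 0 <= t <= 1 -> a <= b -> c <= d ->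
  t * a + (1 - t) * c <= t * b + (1 - t) * d.
Proof.
by move=> /andP[t0 t1] ab cd; rewrite lerD// ler_wpM2l// subr_ge0.
Qed.

Lemma convex_setP (V : lmodType R) (A : set V) :
  convex_set A <-> forall x y (t : R), 0 <= t <= 1 -> A x -> A y ->
    A (t *: x + (1 - t) *: y).
Proof.
split=> [cA x y t /andP[t0 t1] Ax Ay|cA x y t /set_mem Ax /set_mem Ay].
  by apply/set_mem; apply: (cA x y (Itv01 t0 t1)); exact: mem_set.
by apply/mem_set/cA => //; apply/andP; split.
Qed.

Lemma convex_functionP (V : lmodType R) (D : set V) (f : V -> R) :
  convex_function D f <-> forall x y (t : R), 0 <= t <= 1 -> D x -> D y ->
    f (t *: x + (1 - t) *: y) <= t * f x + (1 - t) * f y.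
Proof.
split=> [cf x y t /andP[t0 t1] Dx Dy|cf t x y /set_mem Dx /set_mem Dy].
  by apply: (cf (Itv01 t0 t1)); exact: mem_set.
by apply: cf => //; apply/andP; split.
Qed.

Lemma convex_set_pairP (V : lmodType R) (S : set (V * R^o)) :
  convex_set S <-> forall x r y s (t : R), 0 <= t <= 1 ->
    S (x, r) -> S (y, s) -> S (t *: x + (1 - t) *: y, t * r + (1 - t) * s).
Proof.
split=> [/convex_setP cS x r y s t|cS]; first exact: cS.
by apply/convex_setP => -[x r] [y s] t; exact: cS.
Qed.

End Convexity.

Section Polyhedra.
Context (R : realType).
Implicit Types (n m : nat).

Definition halfspaces n (J : finType) (a : J -> 'cV[R]_n) (b : J -> R) :
  set 'cV[R]_n := [set x | forall j, dotv (a j) x <= b j].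

Lemma polyhedronP n (P : set 'cV[R]_n) :
  polyhedron P <-> exists (J : finType) (a : J -> 'cV[R]_n) (b : J -> R),
    P = halfspaces a b.
Proof.
split=> [[k [G [h ->]]]|[J [a [b ->]]]].
  exists 'I_k, (fun i => (row i G)^T), (fun i => h i 0).
  by apply/seteqP; split=> z Gz i; have := Gz i; rewrite mulmx_dotv.
exists #|J|, (\matrix_i (a (enum_val i))^T), (\col_i b (enum_val i)).
apply/seteqP; split=> z Pz j.
  by rewrite mulmx_dotv rowK trmxK mxE; exact: Pz.
by have := Pz (enum_rank j); rewrite mulmx_dotv rowK trmxK mxE enum_rankK.
Qed.

Lemma polyhedron_convex n (P : set 'cV[R]_n) : polyhedron P -> convex_set P.
Proof.
move=> /polyhedronP[J [a [b ->]]]; apply/convex_setP => x y t t01 Px Py j.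
by have := ler_conv t01 (Px j) (Py j); rewrite dotvDr !dotvZr; lra.
Qed.

Lemma polyhedronT n : polyhedron [set: 'cV[R]_n].
Proof.
apply/polyhedronP; exists void, (fun=> 0), (fun=> 0).
by apply/seteqP; split=> // x _ [].
Qed.

Lemma polyhedronI n (P P' : set 'cV[R]_n) :
  polyhedron P -> polyhedron P' -> polyhedron (P `&` P').
Proof.
move=> /polyhedronP[J [a [b ->]]] /polyhedronP[J' [a' [b' ->]]].
apply/polyhedronP.
pose sum_rect T (f : J -> T) (f' : J' -> T) k :=
  match k with inl j => f j | inr j => f' j end.
exists (J + J')%type, (sum_rect _ a a'), (sum_rect _ b b').
apply/seteqP; split=> [x [Px P'x] [j|j]|x Px]; [exact: Px|exact: P'x|split=> j].
  exact: (Px (inl j)).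
exact: (Px (inr j)).
Qed.

Lemma polyhedron_bigsetI n (I : eqType) (s : seq I) (P : I -> set 'cV[R]_n) :
  (forall i, i \in s -> polyhedron (P i)) ->
  polyhedron (\big[setI/setT]_(i <- s) P i).
Proof.
move=> hP; rewrite big_seq.
by elim/big_ind: _; [exact: polyhedronT|exact: polyhedronI|].
Qed.

Lemma polyhedron_preimage n m (M : 'M[R]_(n, m)) (P : set 'cV[R]_n) :
  polyhedron P -> polyhedron (mulmx M @^-1` P).
Proof.
move=> /polyhedronP[J [a [b ->]]]; apply/polyhedronP.
exists J, (fun j => M^T *m a j), b.
by apply/seteqP; split=> z Pz j; have := Pz j; rewrite dotv_trmx_mul.
Qed.

Lemma exists_between (I J : finType) (lo : I -> R) (up : J -> R) :
  (forall i j, lo i <= up j) ->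
  exists s, (forall i, lo i <= s) /\ (forall j, s <= up j).
Proof.
move=> lo_up; pose top := \big[Num.min/0]_j up j.
exists (\big[Num.max/top]_i lo i); split=> [i|j]; first exact: le_bigmax.
by apply: bigmax_le => [|i _]; [exact: bigmin_le|exact: lo_up].
Qed.

(* One step of Fourier-Motzkin elimination. *)
Lemma polyhedron_add_line n (P : set 'cV[R]_n) e :
  polyhedron P -> polyhedron [set x | exists s, P (x + s *: e)].
Proof.
move=> /polyhedronP[J [a [b ->]]]; apply/polyhedronP.
pose ae j := dotv (a j) e.
pose J0 := {j | ae j == 0}.
pose Jp := {j | 0 < ae j}; pose Jn := {j | ae j < 0}.
pose combine (V : lmodType R) (f : J -> V) (k : J0 + Jp * Jn) := match k with
  | inl j => f (val j)
  | inr (p, q) => (ae (val p))^-1 *: f (val p) - (ae (val q))^-1 *: f (val q)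
  end.
exists (J0 + Jp * Jn)%type, (combine _ a), (combine R^o b).
apply/seteqP; split=> x /=.
- move=> [s Ps]; have {}Ps j : dotv (a j) x <= b j - s * ae j.
    by rewrite lerBrDr -dotvZr -dotvDr; exact: Ps.
  move=> [[j /eqP j0]|[[p p0] [q q0]]] /=.
    by have := Ps j; rewrite j0 mulr0 subr0.
  have p_le : (ae p)^-1 * dotv (a p) x <= (ae p)^-1 * b p - s.
    have := Ps p; rewrite -(@ler_pM2l _ (ae p)^-1) ?invr_gt0//.
    by rewrite mulrBr mulrCA mulVf ?mulr1// lt0r_neq0.
  have q_ge : (ae q)^-1 * b q - s <= (ae q)^-1 * dotv (a q) x.
    have := Ps q; rewrite -(@ler_nM2l _ (ae q)^-1) ?invr_lt0//.
    by rewrite mulrBr mulrCA mulVf ?mulr1// ltr0_neq0.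
  rewrite dotvBl !dotvZl -![_ *: _]/(_ * _); lra.
- move=> Px; pose bound j := (ae j)^-1 * (b j - dotv (a j) x).
  have [|s [lo_s s_up]] := @exists_between _ _ (bound \o val : Jn -> R)
                             (bound \o val : Jp -> R).
    move=> q p; have := Px (inr (p, q)); rewrite /= dotvBl !dotvZl /bound.
    by rewrite -![_ *: _]/(_ * _); lra.
  exists s => j; rewrite dotvDr dotvZr -/(ae j) -lerBrDl.
  have [jn|jp|/eqP j0] := ltgtP (ae j) 0.
  + by have := lo_s (exist _ j jn); rewrite /= /bound mulrC ler_ndivrMr.
  + by have := s_up (exist _ j jp); rewrite /= /bound mulrC ler_pdivlMr.
  + by have := Px (inl (exist _ j j0)); rewrite /= (eqP j0) mulr0 subr_ge0.
Qed.

(* Shortening a feasible step keeps every constraint that the step tightens; a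
   constraint that it relaxes only has to absorb the violation at [y], which is
   at most proportional to [enorm (y - x)]. *)
Lemma polyhedron_add_line_lipschitz n (P : set 'cV[R]_n) e : polyhedron P ->
  exists2 k, 0 <= k & forall x y, P x -> (exists s, P (y + s *: e)) ->
    exists2 s, P (y + s *: e) & enorm (s *: e) <= k * enorm (y - x).
Proof.
move=> /polyhedronP[J [a [b ->]]]; pose ae j := dotv (a j) e.
pose K := \sum_j enorm (a j) / `|ae j|.
have ratio_ge0 j : 0 <= enorm (a j) / `|ae j| by rewrite divr_ge0 ?enorm_ge0.
have K0 : 0 <= K by exact: sumr_ge0.
exists (K * enorm e); first by rewrite mulr_ge0 ?enorm_ge0.
move=> x y Px [s0 Ps0].
pose M := K * enorm (y - x); have M0 : 0 <= M by rewrite mulr_ge0 ?enorm_ge0.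
have short s : `|s| <= M -> enorm (s *: e) <= K * enorm e * enorm (y - x).
  by move=> sM; rewrite enormZ mulrAC ler_wpM2r ?enorm_ge0.
have [s0M|Ms0] := leP `|s0| M; first by exists s0 => //; exact: short.
have s0_gt0 : 0 < `|s0| by exact: le_lt_trans Ms0.
pose t := M / `|s0|; have t0 : 0 <= t by rewrite divr_ge0.
have normE : `|t * s0| = M by rewrite normrM ger0_norm// divfK// gt_eqF.
exists (t * s0); last by rewrite short// normE.
move=> j; have := Ps0 j; rewrite !dotvDr !dotvZr -/(ae j).
have [s0ae|s0ae] := leP 0 (s0 * ae j).
  have t1 : t <= 1 by rewrite ler_pdivrMr// mul1r ltW.
  by have := ler_wpM2r s0ae t1; lra.
have ae0 : 0 < `|ae j|.
  by rewrite normr_gt0; apply: contraTneq s0ae => ->; rewrite mulr0 ltxx.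
have -> : t * s0 * ae j = - (M * `|ae j|).
  by rewrite -normE -normrM -mulrA normrM (ltr0_norm s0ae) ger0_norm//; ring.
have : dotv (a j) (y - x) <= M * `|ae j|.
  rewrite mulrAC; apply: ler_dotv; rewrite -ler_pdivrMr//.
  exact: (@ler_term_sum _ _ (fun j => enorm (a j) / `|ae j|)).
by have := Px j; rewrite dotvBr; lra.
Qed.

Lemma mulmx_split1 n m (N : 'M[R]_(n, 1 + m)) (u : 'cV[R]_(1 + m)) :
  N *m u = rsubmx N *m dsubmx u + usubmx u 0 0 *: lsubmx N.
Proof.
rewrite -{1}(hsubmxK N) -{1}(vsubmxK u) mul_row_col addrC; congr (_ + _).
by rewrite {1}[usubmx u]mx11_scalar mul_mx_scalar.
Qed.

Lemma polyhedron_add_range n m (N : 'M[R]_(n, m)) (P : set 'cV[R]_n) :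
  polyhedron P -> polyhedron [set x | exists u, P (x + N *m u)].
Proof.
elim: m N P => [|m IH] N P hP.
  rewrite [X in polyhedron X](_ : _ = P)//; apply/seteqP; split=> x /=.
    by move=> [u]; rewrite [u]flatmx0 mulmx0 addr0.
  by move=> Px; exists 0; rewrite mulmx0 addr0.
pose N1 : 'M[R]_(n, 1 + m) := N.
have := IH (rsubmx N1) _ (polyhedron_add_line (lsubmx N1) hP).
congr polyhedron; apply/seteqP; split=> x /=.
  move=> [v [s Ps]]; exists (col_mx s%:M v : 'cV_(1 + m)).
  by rewrite (mulmx_split1 N1) col_mxKd col_mxKu mxE addrA.
move=> [u Pu]; pose u1 : 'cV[R]_(1 + m) := u.
exists (dsubmx u1), (usubmx u1 0 0).
by rewrite -addrA -(mulmx_split1 N1).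
Qed.

Lemma polyhedron_add_range_lipschitz n m (N : 'M[R]_(n, m)) (P : set 'cV[R]_n) :
  polyhedron P ->
  exists2 k, 0 <= k & forall x y, P x -> (exists u, P (y + N *m u)) ->
    exists2 u, P (y + N *m u) & enorm (N *m u) <= k * enorm (y - x).
Proof.
elim: m N P => [|m IH] N P hP.
  exists 0 => // x y _ [u]; rewrite [u]flatmx0 mulmx0 addr0 => Py.
  by exists 0; rewrite mulmx0 ?addr0// enorm0 mul0r.
pose N1 : 'M[R]_(n, 1 + m) := N; pose e := lsubmx N1.
have [k k0 lift] := polyhedron_add_line_lipschitz e hP.
have [k' k'0 lift'] := IH (rsubmx N1) _ (polyhedron_add_line e hP).
exists (k' + k * (1 + k')); first by rewrite !(addr_ge0, mulr_ge0).
move=> x y Px [u Pu].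
have [||v Pv vk'] := lift' x y; first by exists 0; rewrite scale0r addr0.
  exists (dsubmx (u : 'cV[R]_(1 + m))), (usubmx (u : 'cV[R]_(1 + m)) 0 0).
  by rewrite -addrA -(mulmx_split1 N1).
have [s Ps sk] := lift x _ Px Pv.
have NE : N *m (col_mx s%:M v : 'cV[R]_(1 + m)) = rsubmx N1 *m v + s *: e.
  by rewrite (mulmx_split1 N1) col_mxKd col_mxKu mxE.
exists (col_mx s%:M v : 'cV[R]_(1 + m)); rewrite NE ?addrA//.
have := ler_enormD (y - x) (rsubmx N1 *m v); rewrite addrAC => dist_le.
apply: le_trans (ler_enormD _ _) _; rewrite mulrDl lerD//.
apply: le_trans sk _; rewrite -mulrA ler_wpM2l// mulrDl mul1r.
by apply: le_trans dist_le _; rewrite lerD2l.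
Qed.

Lemma mulmx_col_01 n m (u : 'cV[R]_m) :
  col_mx (0 : 'M[R]_(n, m)) 1%:M *m u = col_mx 0 u.
Proof. by rewrite mul_col_mx mul0mx mul1mx. Qed.

Lemma polyhedron_projection n m (P : set 'cV[R]_(n + m)) :
  polyhedron P -> polyhedron [set y | exists u, P (col_mx y u)].
Proof.
pose E : 'M[R]_(n + m, n) := col_mx 1%:M 0.
pose N : 'M[R]_(n + m, m) := col_mx 0 1%:M.
move=> /(polyhedron_add_range N)/(polyhedron_preimage E).
congr polyhedron; apply/seteqP; split=> y [u Pu]; exists u; move: Pu.
  by rewrite mulmx_col_01 mul_col_mx mul1mx mul0mx add_col_mx addr0 add0r.
by rewrite /= mulmx_col_01 mul_col_mx mul1mx mul0mx add_col_mx addr0 add0r.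
Qed.

(* Theorem of Walkup and Wets. *)
Lemma polyhedron_sections_lipschitz n m (P : set 'cV[R]_(n + m)) :
  polyhedron P ->
  exists2 k, 0 <= k & forall y u z,
    P (col_mx y u) -> (exists v, P (col_mx z v)) ->
    exists2 v, P (col_mx z v) & enorm (v - u) <= k * enorm (z - y).
Proof.
pose N : 'M[R]_(n + m, m) := col_mx 0 1%:M.
move=> /(polyhedron_add_range_lipschitz N)[k k0 lift].
exists k => // y u z Pyu [v Pzv].
have [|w] := lift (col_mx y u) (col_mx z u) Pyu.
  by exists (v - u); rewrite mulmx_col_01 add_col_mx addr0 subrKC.
rewrite mulmx_col_01 add_col_mx addr0 opp_col_mx add_col_mx subrr.
rewrite enorm_col_mx0 enorm_col_0mx => Pw wk.
by exists (u + w); rewrite // addrAC subrr add0r.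
Qed.

Lemma polyhedra_linear_regularity n (D E : set 'cV[R]_n) :
  polyhedron D -> polyhedron E -> D `&` E !=set0 ->
  exists2 k, 0 <= k & forall y z, D y -> E z ->
    exists2 x, (D `&` E) x & enorm (x - y) <= k * enorm (z - y).
Proof.
move=> hD hE [x0 [Dx0 Ex0]].
pose G :=
  (mulmx (row_mx 0 1%:M) @^-1` D) `&` (mulmx (row_mx 1%:M 1%:M) @^-1` E).
have GE d x : G (col_mx d x) <-> D x /\ E (d + x).
  by rewrite /G /= !mul_row_col mul0mx !mul1mx add0r.
have [|k k0 lip] := @polyhedron_sections_lipschitz n n G.
  by apply: polyhedronI; exact: polyhedron_preimage.
exists k => // y z Dy Ez; have [||x] := lip (z - y) y 0.
- by apply/GE; rewrite subrK.
- by exists x0; apply/GE; rewrite add0r.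
by move=> /GE[Dx]; rewrite add0r sub0r enormN => Ex xk; exists x.
Qed.

End Polyhedra.

Section LinearMinorants.
Context (R : realType).

Lemma convex_opposite_slopes (V : lmodType R) (S : set (V * R^o)) e c d s r :
  convex_set S -> (forall s, S (0, s) -> 0 <= s) -> 0 < c -> 0 < d ->
  S (c *: e, s) -> S (- d *: e, r) -> - r / d <= s / c.
Proof.
move=> /convex_set_pairP convS S0 c0 d0 Sc Sd.
have cd0 : 0 < c + d by rewrite addr_gt0.
have t01 : 0 <= d / (c + d) <= 1.
  by rewrite divr_ge0 ?(ltW d0, ltW cd0)// ler_pdivrMr// mul1r lerDr ltW.
have /S0 : S (0, (d * s + c * r) / (c + d)).
  have := convS _ _ _ _ _ t01 Sc Sd; congr (S (_, _)).
    rewrite !scalerA -scalerDl -[RHS](scale0r e); congr (_ *: _).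
    by field; rewrite gt_eqF.
  by field; rewrite gt_eqF.
rewrite pmulr_lge0 ?invr_gt0// => dscr.
by rewrite ler_pdivlMr// mulrAC ler_pdivrMr//; lra.
Qed.

Lemma line_minorant (V : lmodType R) (S : set (V * R^o)) (e : V) :
  convex_set S -> (forall h, exists s, S (h, s)) ->
  (forall s, S (0, s) -> 0 <= s) ->
  exists tau, forall c s, S (c *: e, s) -> c * tau <= s.
Proof.
move=> convS totS S0.
pose low := [set l | exists d s, [/\ 0 < d, S (- d *: e, s) & l = - s / d]].
have low_le c s : 0 < c -> S (c *: e, s) -> ubound low (s / c).
  by move=> c0 Sc _ [d [r [d0 Sd ->]]]; exact: convex_opposite_slopes Sc Sd.
have low_neq0 : low !=set0.
  by have [s Ss] := totS (- 1 *: e); exists (- s / 1), 1, s.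
have low_ub : has_ubound low.
  by have [s Ss] := totS (1 *: e); exists (s / 1); exact: low_le.
exists (sup low) => c s Sc; have [c0|c0|c0] := ltgtP c 0.
- have : - s / - c <= sup low.
    by apply: ub_le_sup => //; exists (- c), s; rewrite opprK oppr_gt0.
  by rewrite ler_pdivrMr ?oppr_gt0//; lra.
- have : sup low <= s / c by apply: ge_sup => //; exact: low_le.
  by rewrite ler_pdivlMr// mulrC.
- by rewrite c0 mul0r; apply: S0; rewrite -(scale0r e) -c0.
Qed.

(* [S] is the epigraph of a finite convex function that is nonnegative at 0. *)
Lemma hahn_banach n (S : set ('cV[R]_n * R^o)) :
  convex_set S -> (forall h, exists s, S (h, s)) ->
  (forall s, S (0, s) -> 0 <= s) ->
  exists a, forall h s, S (h, s) -> dotv a h <= s.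
Proof.
elim: n S => [|n IH] S convS totS S0.
  by exists 0 => h s; rewrite [h]flatmx0 dotv0l; exact: S0.
pose e : 'cV[R]_(1 + n) := col_mx 1%:M 0.
have [tau tauP] := line_minorant e convS totS S0.
pose join c (h : 'cV[R]_n) : 'cV[R]_(1 + n) := col_mx c%:M h.
have joinD t c d h k : t *: join c h + (1 - t) *: join d k =
    join (t * c + (1 - t) * d) (t *: h + (1 - t) *: k).
  by rewrite /join !scale_col_mx add_col_mx !scale_scalar_mx raddfD.
pose S' : set ('cV[R]_n * R^o) :=
  [set hs | exists c, S (join c hs.1, hs.2 + c * tau)].
have [|h|s [c Sc]|a aP] := IH S'.
- apply/convex_set_pairP => h s k r t t01 [c Sc] [d Sd].
  exists (t * c + (1 - t) * d).
  have := (convex_set_pairP _).1 convS _ _ _ _ _ t01 Sc Sd; congr (S (_, _)).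
    exact: joinD.
  by rewrite /=; ring.
- have [s Ss] := totS (join 0 h); exists s, 0.
  by rewrite mul0r addr0.
- rewrite -(lerD2r (c * tau)) add0r; apply: tauP.
  by rewrite scale_col_mx scaler0 scale_scalar_mx mulr1.
have dotv_join c h : dotv (join tau a) (join c h) = c * tau + dotv a h.
  by rewrite dotv_col_mx /dotv big_ord1 !mxE mulrC.
exists (join tau a) => h s Ss; pose h1 : 'cV[R]_(1 + n) := h.
have hE : h = join (usubmx h1 0 0) (dsubmx h1).
  by rewrite /join -mx11_scalar vsubmxK.
have /aP : S' (dsubmx h1, s - usubmx h1 0 0 * tau).
  by exists (usubmx h1 0 0); rewrite subrK -hE.
rewrite lerBrDl => /(le_trans _); apply.
by rewrite hE -dotv_join.
Qed.

Definition enorm_infconv n (K : R) (E : set ('cV[R]_n * R^o)) :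
  set ('cV[R]_n * R^o) :=
  [set hs | exists y r, E (y, r) /\ r + K * enorm (hs.1 - y) <= hs.2].

Lemma convex_enorm_infconv n (K : R) (E : set ('cV[R]_n * R^o)) :
  0 <= K -> convex_set E -> convex_set (enorm_infconv K E).
Proof.
move=> K0 /convex_set_pairP convE; apply/convex_set_pairP.
move=> h s h' s' t t01 [y [r [Er rs]]] [y' [r' [Er' rs']]].
exists (t *: y + (1 - t) *: y'), (t * r + (1 - t) * r').
split; first exact: convE.
have := ler_wpM2l K0 (ler_enormD (t *: (h - y)) ((1 - t) *: (h' - y'))).
have -> : t *: (h - y) + (1 - t) *: (h' - y') =
    t *: h + (1 - t) *: h' - (t *: y + (1 - t) *: y').
  by rewrite !scalerBr opprD addrACA.
have /andP[t0 t1] := t01; rewrite !enormZ !ger0_norm ?subr_ge0//=.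
by have := ler_conv t01 rs rs'; rewrite /=; lra.
Qed.

Lemma convex_linear_minorant n (E : set ('cV[R]_n * R^o)) (K : R) :
  0 <= K -> convex_set E -> (forall y r, E (y, r) -> - (K * enorm y) <= r) ->
  exists2 b, enorm b <= K & forall y r, E (y, r) -> dotv b y <= r.
Proof.
move=> K0 convE EK.
have [[[y0 r0] E0]|] := pselect (E !=set0); last first.
  by exists 0 => [|y r Eyr]; [rewrite enorm0|case: b; exists (y, r)].
have [|h|s [y [r [/EK]]]|b bS] := @hahn_banach _ (enorm_infconv K E).
- exact: convex_enorm_infconv.
- by exists (r0 + K * enorm (h - y0)), y0, r0.
- by rewrite sub0r enormN /=; lra.
have bE h y r : E (y, r) -> dotv b h <= r + K * enorm (h - y).
  by move=> Eyr; apply: bS; exists y, r.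
exists b => [|y r /(bE y)]; last by rewrite subrr enorm0 mulr0 addr0.
apply: (@enorm_le_of_dotv_le _ _ _ (r0 + K * enorm y0)) => // h.
apply: le_trans (bE h _ _ E0) _; have := ler_wpM2l K0 (ler_enormD h (- y0)).
by rewrite enormN; lra.
Qed.

End LinearMinorants.

Section SubgradientSums.
Context (R : realType).
Implicit Types (n m : nat) (k : R).

Definition lip_on n (K : R) (D : set 'cV[R]_n) (g : 'cV[R]_n -> R) : Prop :=
  forall y z, D y -> D z -> g z <= g y + K * enorm (z - y).

Definition lipschitz_convex n (D : set 'cV[R]_n) (g : 'cV[R]_n -> R) : Prop :=
  [/\ polyhedron D, convex_function D g & exists2 K, 0 <= K & lip_on K D g].

Definition subgradient_on n (D : set 'cV[R]_n) (g : 'cV[R]_n -> R)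
    (x a : 'cV[R]_n) : Prop :=
  forall y, D y -> g x + dotv a (y - x) <= g y.

Lemma lipschitz_convexT0 n : lipschitz_convex [set: 'cV[R]_n] (fun=> 0).
Proof.
split; [exact: polyhedronT| |].
  by apply/convex_functionP => *; rewrite !mulr0 addr0.
by exists 0 => // y z _ _; rewrite mul0r addr0.
Qed.

Lemma lipschitz_convexD n (D E : set 'cV[R]_n) f g :
  lipschitz_convex D f -> lipschitz_convex E g ->
  lipschitz_convex (D `&` E) (fun x => f x + g x).
Proof.
move=> [hD /convex_functionP convf [K K0 Kf]].
move=> [hE /convex_functionP convg [K' K'0 Kg]].
split; first exact: polyhedronI.
  apply/convex_functionP => x y t t01 [Dx Ex] [Dy Ey].
  by have := convf _ _ _ t01 Dx Dy; have := convg _ _ _ t01 Ex Ey; lra.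
exists (K + K') => [|y z [Dy Ey] [Dz Ez]]; first exact: addr_ge0.
by have := Kf _ _ Dy Dz; have := Kg _ _ Ey Ez; lra.
Qed.

Lemma lipschitz_convexZ n (D : set 'cV[R]_n) f k : 0 <= k ->
  lipschitz_convex D f -> lipschitz_convex D (fun x => k * f x).
Proof.
move=> k0 [hD /convex_functionP convf [K K0 Kf]]; split=> //.
  apply/convex_functionP => x y t t01 Dx Dy.
  by have := ler_wpM2l k0 (convf _ _ _ t01 Dx Dy); lra.
exists (k * K) => [|y z Dy Dz]; first exact: mulr_ge0.
by have := ler_wpM2l k0 (Kf _ _ Dy Dz); lra.
Qed.

Lemma lipschitz_convex_preimage n m (M : 'M[R]_(n, m)) (D : set 'cV[R]_n) f :
  lipschitz_convex D f -> lipschitz_convex (mulmx M @^-1` D) (f \o mulmx M).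
Proof.
move=> [hD /convex_functionP convf [K K0 Kf]].
split; first exact: polyhedron_preimage.
  apply/convex_functionP => x y t t01 Dx Dy /=.
  by rewrite mulmxDr -!scalemxAr convf.
have [k k0 kM] := enorm_mulmx_bounded M.
exists (K * k) => [|y z Dy Dz /=]; first exact: mulr_ge0.
apply: le_trans (Kf _ _ Dy Dz) _; rewrite lerD2l -mulrA ler_wpM2l//.
by rewrite -mulmxBr kM.
Qed.

Lemma lipschitz_convex_bigsum n (I : choiceType) (s : seq I)
    (D : I -> set 'cV[R]_n) (g : I -> 'cV[R]_n -> R) :
  (forall i, i \in s -> lipschitz_convex (D i) (g i)) ->
  lipschitz_convex (\big[setI/setT]_(i <- s) D i)
    (fun y => \sum_(i <- s) g i y).
Proof.
elim: s => [|i s IH] hs; rewrite ?big_cons.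
  under [X in lipschitz_convex _ X]eq_fun do rewrite big_nil.
  by rewrite big_nil; exact: lipschitz_convexT0.
under [X in lipschitz_convex _ X]eq_fun do rewrite big_cons.
apply: lipschitz_convexD; first by apply: hs; rewrite mem_head.
by apply: IH => j js; apply: hs; rewrite inE js orbT.
Qed.

Lemma calm_subgradient n (D : set 'cV[R]_n) (g : 'cV[R]_n -> R) x L : 0 <= L ->
  convex_set D -> convex_function D g ->
  (forall y, D y -> g x <= g y + L * enorm (x - y)) ->
  exists2 a, enorm a <= L & subgradient_on D g x a.
Proof.
move=> L0 /convex_setP convD /convex_functionP convg calm.
pose E : set ('cV[R]_n * R^o) :=
  [set hs | D (x + hs.1) /\ g (x + hs.1) <= g x + hs.2].
have [|h s /= [/calm]|a aL aE] := @convex_linear_minorant _ n E L L0.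
- apply/convex_set_pairP => h s h' s' t t01 [Dh hE] [Dh' h'E].
  have xE : x + (t *: h + (1 - t) *: h') = t *: (x + h) + (1 - t) *: (x + h').
    by rewrite !scalerDr addrACA -scalerDl subrKC scale1r.
  rewrite /E /= xE; split; first exact: convD.
  apply: le_trans (convg _ _ _ t01 Dh Dh') _.
  by have := ler_conv t01 hE h'E; rewrite /=; lra.
- by rewrite opprD addNKr enormN /=; lra.
exists a => // y Dy; rewrite -lerBrDl.
by apply: aE; rewrite /E /= !subrKC.
Qed.

Lemma lipschitz_convex_decouple n (D E : set 'cV[R]_n) f g a (c : R) :
  lipschitz_convex D f -> lipschitz_convex E g -> D `&` E !=set0 ->
  (forall w, D w -> E w -> c + dotv a w <= f w + g w) ->
  exists2 M, 0 <= M & forall y z, D y -> E z ->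
    c + dotv a z - M * enorm (y - z) <= f y + g z.
Proof.
move=> [hD _ [K K0 Kf]] [hE _ [K' K'0 Kg]] DE0 aw_le.
have [k k0 reg] := polyhedra_linear_regularity hD hE DE0.
exists (K * k + (K' + enorm a) * (1 + k)) => [|y z Dy Ez].
  by rewrite !(addr_ge0, mulr_ge0)// enorm_ge0.
have [w [Dw Ew] wy] := reg _ _ Dy Ez; rewrite (enorm_distC z) in wy.
have wz : enorm (w - z) <= (1 + k) * enorm (y - z).
  apply: le_trans (ler_enorm_dist w y z) _.
  by rewrite mulrDl mul1r addrC lerD2l.
have fw := le_trans (Kf _ _ Dy Dw) (lerD (lexx _) (ler_wpM2l K0 wy)).
have gw := le_trans (Kg _ _ Ez Ew) (lerD (lexx _) (ler_wpM2l K'0 wz)).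
have azw : dotv a (z - w) <= enorm a * ((1 + k) * enorm (y - z)).
  apply: le_trans (cauchy_schwarz a (z - w)) _.
  by rewrite ler_wpM2l ?enorm_ge0// enorm_distC.
by have := aw_le w Dw Ew; rewrite dotvBr in azw; lra.
Qed.

Lemma subgradient_onD n (D E : set 'cV[R]_n) f g x a :
  lipschitz_convex D f -> lipschitz_convex E g -> D x -> E x ->
  subgradient_on (D `&` E) (fun y => f y + g y) x a ->
  exists2 b, subgradient_on D f x b & subgradient_on E g x (a - b).
Proof.
move=> Df Eg Dx Ex asub; pose c := f x + g x - dotv a x.
have [|w Dw Ew|M M0 M_le] := @lipschitz_convex_decouple _ _ _ _ _ a c Df Eg.
- by exists x.
- by have := asub w (conj Dw Ew); rewrite dotvBr /c; lra.
pose gap y z := f y + g z - (c + dotv a z).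
pose G : set ('cV[R]_n * R^o) :=
  [set hs | exists y z, [/\ D y, E z, hs.1 = y - z & gap y z <= hs.2]].
have [hD convf _] := Df; have [hE convg _] := Eg.
have [|y r [u [v [Du Ev /= -> uvr]]]|b _ bG] :=
    @convex_linear_minorant _ n G M M0.
- apply/convex_set_pairP => h s h' s' t t01.
  move=> [y [z [Dy Ez /= -> sE]]] [y' [z' [Dy' Ez' /= -> s'E]]].
  exists (t *: y + (1 - t) *: y'), (t *: z + (1 - t) *: z'); split.
  + by apply: (convex_setP _).1 => //; exact: polyhedron_convex.
  + by apply: (convex_setP _).1 => //; exact: polyhedron_convex.
  + by rewrite /= !scalerBr opprD addrACA.
  + have := ler_conv t01 sE s'E.
    have := (convex_functionP _ _).1 convf _ _ _ t01 Dy Dy'.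
    have := (convex_functionP _ _).1 convg _ _ _ t01 Ez Ez'.
    by rewrite /gap dotvDr !dotvZr /=; lra.
- by apply: le_trans uvr; have := M_le u v Du Ev; rewrite /gap; lra.
have bgap y z : D y -> E z -> dotv b (y - z) <= gap y z.
  by move=> Dy Ez; apply: bG; exists y, z.
exists b => y Dy; [have := bgap y x Dy Ex|have := bgap x y Dx Dy].
  by rewrite /gap /c; lra.
by rewrite /gap /c dotvBl -(opprB y x) dotvNr !dotvBr; lra.
Qed.

Lemma subgradient_on_bigsum n (I : choiceType) (s : seq I)
    (D : I -> set 'cV[R]_n) (g : I -> 'cV[R]_n -> R) x a :
  uniq s -> (forall i, i \in s -> lipschitz_convex (D i) (g i)) ->
  (forall i, i \in s -> D i x) ->
  subgradient_on (\big[setI/setT]_(i <- s) D i)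
    (fun y => \sum_(i <- s) g i y) x a ->
  exists2 b : I -> 'cV[R]_n, a = \sum_(i <- s) b i &
    forall i, i \in s -> subgradient_on (D i) (g i) x (b i).
Proof.
elim: s a => [|i s IH] a.
  move=> _ _ _ asub; exists (fun=> 0) => //; rewrite big_nil; apply: enorm_eq0.
  apply/eqP; rewrite -sqrf_eq0 sqr_enorm eq_le dotvv_ge0 andbT.
  have := asub (x + a); rewrite !big_nil add0r addrAC subrr add0r; exact.
move=> /= /andP[i_s us] hs Dx; rewrite big_cons => asub.
have [i_is s_is] : i \in i :: s /\ {subset s <= i :: s}.
  by split=> [|j js]; rewrite inE ?eqxx// js orbT.
have lcrest := lipschitz_convex_bigsum (fun j js => hs j (s_is j js)).
have [||b bi brest] :=
    subgradient_onD (a := a) (hs i i_is) lcrest (Dx i i_is).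
- by rewrite -bigcap_seq => j /= /s_is/Dx.
- by move=> y Dy; have := asub y Dy; rewrite !big_cons.
have [||||b' abE b's] := IH (a - b) => //.
- by move=> j /s_is/hs.
- by move=> j /s_is/Dx.
exists (fun j => if j == i then b else b' j) => [|j].
  rewrite big_cons eqxx (eq_big_seq b') -?abE ?subrKC// => j js.
  by case: eqVneq => // ji; rewrite -ji js in i_s.
by rewrite inE; case: eqVneq => [->//|_ /= /b's].
Qed.

Lemma subgradient_onZ n (D : set 'cV[R]_n) g x a k : 0 < k ->
  subgradient_on D (fun y => k * g y) x a -> subgradient_on D g x (k^-1 *: a).
Proof.
move=> k0 asub y Dy; rewrite dotvZl -(ler_pM2l k0) mulrDr mulVKf ?gt_eqF//.
exact: asub.
Qed.

End SubgradientSums.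

Section ExtendedFunctions.
Context (R : realType).
Implicit Types (n m : nat).

Definition pinfty_ext (V : Type) (D : set V) (g : V -> R) : V -> \bar R :=
  fun y => ((g y)%:E + delta R D y)%E.

Lemma pinfty_ext_in (V : Type) (D : set V) g y :
  D y -> pinfty_ext D g y = (g y)%:E.
Proof. by move=> Dy; rewrite /pinfty_ext /delta asboolT// adde0. Qed.

Lemma pinfty_ext_out (V : Type) (D : set V) g y :
  ~ D y -> pinfty_ext D g y = +oo%E.
Proof. by move=> nDy; rewrite /pinfty_ext /delta asboolF. Qed.

Lemma pinfty_ext_lty (V : Type) (D : set V) g y :
  (pinfty_ext D g y < +oo)%E <-> D y.
Proof.
split=> [|Dy]; last by rewrite pinfty_ext_in// ltry.
by apply: contraPP => nDy; rewrite pinfty_ext_out.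
Qed.

Lemma ereal_inf_pinfty_ext (V : Type) (D : set V) g :
  has_lbound [set g y | y in D] -> D !=set0 ->
  ereal_inf (range (pinfty_ext D g)) = (inf [set g y | y in D])%:E.
Proof.
move=> lbg [y0 Dy0]; rewrite -ereal_inf_EFin//; last by exists (g y0), y0.
apply/eqP; rewrite eq_le; apply/andP; split.
  apply: ereal_inf_le_tmp => _ [_ [y Dy <-] <-].
  by exists y => //; rewrite pinfty_ext_in.
apply: le_ereal_inf_tmp => _ [y _ <-].
have [Dy|nDy] := pselect (D y); last by rewrite pinfty_ext_out// leey.
rewrite pinfty_ext_in//.
by apply: ereal_inf_lbound; exists (g y) => //; exists y.
Qed.

Lemma subgradient_pinfty_ext n (D : set 'cV[R]_n) g x a :
  D x -> subgradient_on D g x a -> subgradient (pinfty_ext D g) x a.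
Proof.
move=> Dx asub; split=> [|y]; rewrite !(pinfty_ext_in _ Dx)//.
have [Dy|nDy] := pselect (D y); last by rewrite pinfty_ext_out// leey.
by rewrite pinfty_ext_in// -EFinD lee_fin; exact: asub.
Qed.

Lemma pinfty_extD (V : Type) (D E : set V) f g y :
  (pinfty_ext D f y + pinfty_ext E g y)%dE =
  pinfty_ext (D `&` E) (fun y => f y + g y) y.
Proof.
have [Dy|nDy] := pselect (D y); last first.
  by rewrite (pinfty_ext_out f nDy) daddye pinfty_ext_out// => -[].
have [Ey|nEy] := pselect (E y); last first.
  by rewrite (pinfty_ext_out g nEy) daddey pinfty_ext_out// => -[].
by rewrite !pinfty_ext_in.
Qed.

Lemma pinfty_extZ (V : Type) (D : set V) g k y : 0 < k ->
  (k%:E * pinfty_ext D g y)%E = pinfty_ext D (fun y => k * g y) y.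
Proof.
move=> k0; have [Dy|nDy] := pselect (D y); first by rewrite !pinfty_ext_in.
by rewrite !pinfty_ext_out// gt0_muley.
Qed.

Lemma dsum_pinfty_ext (V : Type) (I : eqType) (s : seq I) (p : I -> R)
    (D : I -> set V) (g : I -> V -> R) y :
  (forall i, i \in s -> 0 < p i) ->
  (\sum_(i <- s) ((p i)%:E * pinfty_ext (D i) (g i) y)%E)%dE =
  pinfty_ext (\big[setI/setT]_(i <- s) D i)
    (fun y => \sum_(i <- s) p i * g i y) y.
Proof.
elim: s => [|i s IH] p0; first by rewrite !big_nil pinfty_ext_in// big_nil.
rewrite !big_cons pinfty_extZ ?p0 ?mem_head// IH => [|j js]; last first.
  by rewrite p0// inE js orbT.
by rewrite pinfty_extD; congr pinfty_ext; apply/funext => z; rewrite big_cons.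
Qed.

Lemma lip_on_has_lbound n (K : R) (D A : set 'cV[R]_n) g :
  0 <= K -> lip_on K D g -> A `<=` D ->
  (exists M, forall z, A z -> enorm z <= M) ->
  has_lbound [set g z | z in A].
Proof.
move=> K0 lipg AD [M AM]; have [[z0 Az0]|A0] := pselect (A !=set0); last first.
  by exists 0 => _ [z Az <-]; case: A0; exists z.
exists (g z0 - K * (M + M)) => _ [z Az <-]; rewrite lerBlDr.
apply: le_trans (lipg _ _ (AD _ Az) (AD _ Az0)) _; rewrite lerD2l ler_wpM2l//.
by apply: le_trans (ler_enormD _ _) _; rewrite enormN lerD ?AM.
Qed.

Lemma lipschitz_on_le n (L : R) (A : set 'cV[R]_n) f y z :
  Defs.lipschitz_on L A f -> A y -> A z ->
  (f z <= f y + (L * enorm (z - y))%:E)%E.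
Proof.
move=> [ffin flip] Ay Az; have := flip _ _ Az Ay.
rewrite -(fineK (ffin _ Ay)) -(fineK (ffin _ Az)).
rewrite -EFinB abse_EFin -EFinD !lee_fin.
by move=> /(le_trans (ler_norm _)); lra.
Qed.

Lemma lipschitz_on_pinfty_ext n (L : R) (D : set 'cV[R]_n) g :
  Defs.lipschitz_on L D (pinfty_ext D g) <-> lip_on L D g.
Proof.
split=> [lipg y z Dy Dz|lipg].
  have := lipschitz_on_le lipg Dy Dz.
  by rewrite !pinfty_ext_in// -EFinD lee_fin.
split=> [y Dy|y z Dy Dz]; first by rewrite pinfty_ext_in.
rewrite !pinfty_ext_in// -EFinB abse_EFin lee_fin ler_norml.
have := lipg _ _ Dy Dz; have := lipg _ _ Dz Dy; rewrite (enorm_distC z y).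
by move=> gyz gzy; apply/andP; split; lra.
Qed.

Lemma interior_subgradient_le n (X : set 'cV[R]_n) (L : R)
    (f : 'cV[R]_n -> \bar R) (x a : 'cV[R]_n) :
  0 <= L -> Defs.lipschitz_on L X f -> interior X x ->
  (forall y, X y -> (f x + (dotv a (y - x))%:E <= f y)%E) -> enorm a <= L.
Proof.
move=> L0 lipf Xx asub; have X_x := nbhs_singleton Xx.
have cvgx : x + t *: a @[t --> (0 : R)^'+] --> x.
  rewrite -[X in _ --> X]addr0 -(scale0r a); apply: cvgD; first exact: cvg_cst.
  by apply: cvgZr_tmp; exact: cvg_at_right_filter.
near (0 : R)^'+ => t.
have t0 : 0 < t by near: t; exact: nbhs_right_gt.
have Xt : X (x + t *: a) by near: t; exact: cvgx.
have := le_trans (asub _ Xt) (lipschitz_on_le lipf X_x Xt).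
have [ffin _] := lipf; rewrite -(fineK (ffin _ X_x)) -!EFinD lee_fin lerD2l.
rewrite addrAC subrr add0r dotvZr enormZ gtr0_norm// -sqr_enorm expr2 => at_le.
have [->//|a0] := eqVneq (enorm a) 0.
have ta0 : 0 < t * enorm a by rewrite mulr_gt0// lt_def a0 enorm_ge0.
by rewrite -(ler_pM2l ta0); lra.
Unshelve. all: by end_near. Qed.

Lemma sup_affine_convex_lip n (J : Type) (A : set J) (c : J -> 'cV[R]_n)
    (e : J -> R) (D : set 'cV[R]_n) (K : R) :
  convex_set D -> A !=set0 -> (forall j, A j -> enorm (c j) <= K) ->
  (forall y, D y -> has_ubound [set dotv (c j) y + e j | j in A]) ->
  let g y := sup [set dotv (c j) y + e j | j in A] in
  convex_function D g /\ lip_on K D g.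
Proof.
move=> /convex_setP convD [i Ai] cK ubA g.
have le_g y j : D y -> A j -> dotv (c j) y + e j <= g y.
  by move=> Dy Aj; apply: ub_le_sup; [exact: ubA|exists j].
have g_le y r : (forall j, A j -> dotv (c j) y + e j <= r) -> g y <= r.
  move=> cr; apply: ge_sup => [|_ [j Aj <-]]; last exact: cr.
  by exists (dotv (c i) y + e i), i.
split=> [|y z Dy Dz].
  apply/convex_functionP => y z t t01 Dy Dz; apply: g_le => j Aj.
  have := ler_conv t01 (le_g y j Dy Aj) (le_g z j Dz Aj).
  by rewrite dotvDr !dotvZr; lra.
apply: g_le => j Aj; have := ler_dotv (z - y) (cK j Aj).
by have := le_g y j Dy Aj; rewrite dotvBr; lra.
Qed.

Lemma bigmax_affine_pinfty_ext n (I : finType) (c : I -> 'cV[R]_n) (e : I -> R)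
    (P : set 'cV[R]_n) : (0 < #|I|)%N -> polyhedron P ->
  exists2 g, lipschitz_convex P g & forall z,
    (\big[maxe/-oo]_i (dotv (c i) z + e i)%:E + delta R P z)%E =
    pinfty_ext P g z.
Proof.
move=> /card_gt0P[i0 _] hP.
pose g z := sup [set dotv (c i) z + e i | i in [set: I]].
have ubI z : has_ubound [set dotv (c i) z + e i | i in [set: I]].
  exists (\sum_i `|dotv (c i) z + e i|) => _ [i _ <-].
  by apply: le_trans (ler_norm _) _; exact: ler_term_sum.
pose K := \sum_i enorm (c i).
have [||||convg lipg] := @sup_affine_convex_lip n I setT c e P K.
- exact: polyhedron_convex.
- by exists i0.
- by move=> i _; apply: ler_term_sum => j; exact: enorm_ge0.
- by move=> z _.
exists g => [|z].
  by split=> //; exists K => //; apply: sumr_ge0 => i _; exact: enorm_ge0.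
congr (_ + _)%E; apply/eqP; rewrite eq_le; apply/andP; split.
  apply: bigmax_le => [|i _]; rewrite ?leNye// lee_fin.
  by apply: ub_le_sup => //; exists i.
rewrite -ereal_sup_EFin//; last by exists (dotv (c i0) z + e i0), i0.
apply: ge_ereal_sup => _ [_ [i _ <-] <-].
exact: (le_bigmax _ (fun i => (dotv (c i) z + e i)%:E)).
Qed.

Lemma sup_of_affine_pinfty_ext n (X : set 'cV[R]_n) (L : R)
    (F : set ('cV[R]_n -> \bar R)) :
  0 <= L -> polyhedron X ->
  (forall f, F f -> exists (a : 'cV[R]_n) (b : R),
     enorm a <= L /\ f = pinfty_ext X (fun y => dotv a y + b)) ->
  F !=set0 -> (exists2 y, X y & (sup_of F y < +oo)%E) ->
  exists phi, [/\ lipschitz_convex X phi, lip_on L X phi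
                 & sup_of F = pinfty_ext X phi].
Proof.
move=> L0 hX Faff [f0 Ff0] [y0 Xy0 sup_lty].
have le_sup f y : F f -> (f y <= sup_of F y)%E.
  by move=> Ff; apply: ereal_sup_ubound; exists f.
have [M supM] : exists M : R, (sup_of F y0 <= M%:E)%E.
  case: (sup_of F y0) sup_lty => [r _| |_]//; first by exists r.
  by exists 0; rewrite leNye.
pose A := [set ab : 'cV[R]_n * R | enorm ab.1 <= L /\
  F (pinfty_ext X (fun y => dotv ab.1 y + ab.2))].
have FA f : F f ->
    exists2 ab, A ab & f = pinfty_ext X (fun y => dotv ab.1 y + ab.2).
  move=> /[dup] Ff /Faff[a [b [aL fE]]].
  by exists (a, b) => //; split; rewrite -?fE.
have A_neq0 : A !=set0 by have [ab Aab _] := FA _ Ff0; exists ab.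
have ubA y : X y -> has_ubound [set dotv ab.1 y + ab.2 | ab in A].
  move=> Xy; exists (M + L * enorm (y - y0)) => _ [[a b] [/= aL Fab] <-].
  have := le_trans (le_sup _ y0 Fab) supM; rewrite pinfty_ext_in// lee_fin.
  by have := ler_dotv (y - y0) aL; rewrite dotvBr; lra.
have AL ab : A ab -> enorm ab.1 <= L by case.
have [convphi lipphi] :=
  sup_affine_convex_lip (polyhedron_convex hX) A_neq0 AL ubA.
exists (fun y => sup [set dotv ab.1 y + ab.2 | ab in A]); split=> //.
  by split=> //; exists L.
apply/funext => y; have [Xy|nXy] := pselect (X y); last first.
  rewrite pinfty_ext_out//; apply/eqP; rewrite -leye_eq.
  have [ab _ fE] := FA _ Ff0.
  by have := le_sup _ y Ff0; rewrite fE pinfty_ext_out.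
rewrite pinfty_ext_in// -ereal_sup_EFin//; last 2 first.
- exact: ubA.
- by have [ab Aab] := A_neq0; exists (dotv ab.1 y + ab.2), ab.
congr ereal_sup; apply/seteqP; split=> [_ [f /FA[cb Acb ->] <-]|].
  by rewrite pinfty_ext_in//; exists (dotv cb.1 y + cb.2) => //; exists cb.
move=> _ [_ [cb [_ Fcb] <-] <-].
by exists (pinfty_ext X (fun y => dotv cb.1 y + cb.2)); rewrite ?pinfty_ext_in.
Qed.

Lemma lipschitz_convex_sections n m (D : set 'cV[R]_(n + m)) g :
  lipschitz_convex D g ->
  exists2 K, 0 <= K & forall y u z,
    D (col_mx y u) -> (exists v, D (col_mx z v)) ->
    exists2 v, D (col_mx z v) &
      g (col_mx z v) <= g (col_mx y u) + K * enorm (z - y).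
Proof.
move=> [hD _ [K K0 lipg]]; have [k k0 lipD] := polyhedron_sections_lipschitz hD.
exists (K * (1 + k)) => [|y u z Dyu Dz]; first by rewrite mulr_ge0 ?addr_ge0.
have [v Dzv vk] := lipD _ _ _ Dyu Dz; exists v => //.
apply: le_trans (lipg _ _ Dyu Dzv) _.
rewrite lerD2l -mulrA ler_wpM2l// mulrDl mul1r opp_col_mx add_col_mx.
by apply: le_trans (ler_enorm_col_mx _ _) _; rewrite lerD2l.
Qed.

Lemma lipschitz_convex_inf_projection n m (D : set 'cV[R]_(n + m)) g y0 :
  lipschitz_convex D g -> (exists u, D (col_mx y0 u)) ->
  has_lbound [set g (col_mx y0 u) | u in [set u | D (col_mx y0 u)]] ->
  exists2 f, lipschitz_convex [set y | exists u, D (col_mx y u)] f &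
    forall y, ereal_inf (range (fun u => pinfty_ext D g (col_mx y u))) =
      pinfty_ext [set y | exists u, D (col_mx y u)] f y.
Proof.
move=> Dg D0 [l l_lb]; have [K K0 slide] := lipschitz_convex_sections Dg.
have [hD /convex_functionP convg _] := Dg.
have /convex_setP convD := polyhedron_convex hD.
pose vals y := [set g (col_mx y u) | u in [set u | D (col_mx y u)]].
have vals_lb y : has_lbound (vals y).
  exists (l - K * enorm (y0 - y)) => _ [u Dyu <-].
  have [v Dv] := slide _ _ _ Dyu D0; rewrite lerBlDr; apply: le_trans.
  by apply: l_lb; exists v.
have vals_neq0 y : (exists u, D (col_mx y u)) -> vals y !=set0.
  by move=> [u Dyu]; exists (g (col_mx y u)), u.
have inf_le y u : D (col_mx y u) -> inf (vals y) <= g (col_mx y u).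
  by move=> Dyu; apply: ge_inf; [exact: vals_lb|exists u].
exists (inf \o vals); [split|] => [||| y] /=.
- exact: polyhedron_projection.
- apply/convex_functionP => y z t t01 Dy Dz; apply/ler_addgt0Pr => eps eps0.
  have [_ [u Dyu <-] ueps] :=
    inf_adherent eps0 (conj (vals_neq0 y Dy) (vals_lb y)).
  have [_ [v Dzv <-] veps] :=
    inf_adherent eps0 (conj (vals_neq0 z Dz) (vals_lb z)).
  have := convg _ _ _ t01 Dyu Dzv; have := convD _ _ _ t01 Dyu Dzv.
  rewrite !scale_col_mx add_col_mx => /inf_le infuv /(le_trans infuv) le_uv.
  by have := ler_conv t01 (ltW ueps) (ltW veps); move: le_uv; rewrite /=; lra.
- exists K => // y z Dy Dz; rewrite -lerBlDr.
  apply: lb_le_inf; first exact: vals_neq0.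
  move=> _ [u Dyu <-]; have [v Dzv gv] := slide _ _ _ Dyu Dz.
  by rewrite lerBlDr; apply: le_trans (inf_le _ _ Dzv) gv.
have [Dy|nDy] := pselect (exists u, D (col_mx y u)).
  by rewrite pinfty_ext_in//; exact: ereal_inf_pinfty_ext (vals_lb y) Dy.
rewrite pinfty_ext_out//; apply/eqP; rewrite -leye_eq; apply: le_ereal_inf_tmp.
by move=> _ [u _ <-]; rewrite pinfty_ext_out// => Dyu; apply: nDy; exists u.
Qed.

End ExtendedFunctions.

Section BellmanOperator.
Context (R : realType) (d : measure_display) (Omega : measurableType d)
  (Pr : probability Omega R) (dW : measure_display) (TW : measurableType dW)
  (n m : nat) (Q : lp_problem Pr TW n m).
Hypotheses (measurable_sing : forall w : TW, measurable [set w])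
  (Q_lp : linear_polyhedral Q)
  (fin_noise : forall t, (1 <= t <= lp_T Q)%N -> finitely_supported (lp_W Q t)).
Implicit Types (t : nat) (w : TW).

Local Notation T := (lp_T Q).
Local Notation supp t := (fset_set (lp_supp Q t)).

Lemma finite_lp_supp t : (t < T)%N -> finite_set (lp_supp Q t).
Proof. by move=> tT; have [] := fin_noise (t := t.+1) tT. Qed.

Lemma suppP t w : (t < T)%N -> w \in supp t <-> lp_supp Q t w.
Proof.
move=> /finite_lp_supp fin_supp; rewrite in_fset_set//.
by split=> [/set_mem|/mem_set].
Qed.

Lemma lp_p_gt0 t w : lp_supp Q t w -> 0 < lp_p Q t w.
Proof.
move=> w0; apply: fine_gt0; rewrite w0/=.
apply: le_lt_trans (ltry 1); apply: probability_le1.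
exact: measurable_funPTI.
Qed.

Lemma fsbig_supp (V : Type) (idx : V) (op : Monoid.com_law idx) t
    (F : TW -> V) : (t < T)%N ->
  \big[op/idx]_(w \in lp_supp Q t) F w = \big[op/idx]_(w <- supp t) F w.
Proof. by move=> tT; rewrite fsbig_finite//; exact: finite_lp_supp. Qed.

Lemma bellman_ge t phi y (b : TW -> R) : (t < T)%N ->
  (forall w, lp_supp Q t w -> ((b w)%:E <= bellman_w Q t w phi y)%E) ->
  ((\sum_(w \in lp_supp Q t) lp_p Q t w * b w)%:E <= bellman Q t phi y)%E.
Proof.
move=> tT le_b; rewrite /bellman !fsbig_supp// -dsumEFin big_seq [leRHS]big_seq.
elim/big_rec2: _ => // w z1 z2 /(suppP _ tT) wS z12; apply: lee_dD => //.
by rewrite EFinM lee_wpmul2l ?le_b// lee_fin ltW// lp_p_gt0.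
Qed.

Lemma bellman_eq t phi y (b : TW -> R) : (t < T)%N ->
  (forall w, lp_supp Q t w -> bellman_w Q t w phi y = (b w)%:E) ->
  bellman Q t phi y = (\sum_(w \in lp_supp Q t) lp_p Q t w * b w)%:E.
Proof.
move=> tT bE; rewrite /bellman !fsbig_supp// -dsumEFin.
by apply: eq_big_seq => w /(suppP _ tT)/bE ->.
Qed.

Lemma bellman_outside t phi y : (t < T)%N -> ~ stateX Q t y ->
  bellman Q t phi y = +oo%E.
Proof.
move=> tT; rewrite /stateX tT => /existsNP[w /not_implyP[wS infeasible]].
have wB : bellman_w Q t w phi y = +oo%E.
  apply/eqP; rewrite -leye_eq; apply: le_ereal_inf_tmp => _ [u _ <-].
  suff -> : cost Q t w y u = +oo%E by rewrite daddye.
  apply/eqP; rewrite -leye_eq leNgt; apply/negP => yu.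
  by apply: infeasible; exists u.
rewrite /bellman fsbig_supp// (bigD1_seq w)/= ?fset_uniq//; last exact/suppP.
by rewrite wB gt0_muley ?daddye// lte_fin lp_p_gt0.
Qed.

Lemma cost_pinfty_ext t w : (t < T)%N -> lp_supp Q t w ->
  exists2 g, lipschitz_convex (lp_P Q t w) g &
    forall x u, cost Q t w x u = pinfty_ext (lp_P Q t w) g (col_mx x u).
Proof.
have [_ I0 hP _ _] := Q_lp => tT wS.
have [g lcg gE] := bigmax_affine_pinfty_ext
  (fun i => @lp_c _ _ _ _ _ _ _ _ Q t i w)
  (fun i => @lp_d _ _ _ _ _ _ _ _ Q t i w) (I0 t (ltnW tT)) (hP t w tT wS).
by exists g => // x u; exact: gE.
Qed.

Lemma cost_lty t w x u : (t < T)%N -> lp_supp Q t w ->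
  (cost Q t w x u < +oo)%E <-> lp_P Q t w (col_mx x u).
Proof.
by move=> tT wS; have [g _ ->] := cost_pinfty_ext tT wS; exact: pinfty_ext_lty.
Qed.

Lemma final_cost_pinfty_ext :
  exists2 g, lipschitz_convex (lp_XT Q) g &
    final_cost Q = pinfty_ext (lp_XT Q) g.
Proof.
have [_ I0 _ _ [hXT _]] := Q_lp.
have [g lcg gE] := bigmax_affine_pinfty_ext (@lp_cT _ _ _ _ _ _ _ _ Q)
  (@lp_dT _ _ _ _ _ _ _ _ Q) (I0 T (leqnn _)) hXT.
by exists g => //; apply/funext.
Qed.

Lemma stateX_final : stateX Q T = lp_XT Q.
Proof.
have [g _ gE] := final_cost_pinfty_ext; rewrite /stateX ltnn /edom gE.
by apply/seteqP; split=> x /=; rewrite pinfty_ext_lty.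
Qed.

Lemma stateX_polyhedron t : (t <= T)%N -> polyhedron (stateX Q t).
Proof.
have [_ _ hP _ [hXT _]] := Q_lp.
rewrite leq_eqVlt => /orP[/eqP ->|tT]; first by rewrite stateX_final.
have -> : stateX Q t =
    \bigcap_(w in lp_supp Q t) [set x | exists u, lp_P Q t w (col_mx x u)].
  rewrite /stateX tT; apply/seteqP; split=> x Xx w wS; have [u Xu] := Xx w wS.
    by exists u; apply/cost_lty.
  by exists u; apply/cost_lty.
rewrite -(fset_setK (finite_lp_supp tT)) bigcap_seq.
apply: polyhedron_bigsetI => w /(suppP _ tT) wS.
exact/polyhedron_projection/hP.
Qed.

Definition control_dom t w : set 'cV[R]_n := [set x | controlU Q t w x !=set0].

Lemma stage_cost_pinfty_ext t w f : (t < T)%N -> lp_supp Q t w ->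
  lipschitz_convex (stateX Q t.+1) f ->
  exists (D : set 'cV[R]_(n + m)) g,
  [/\ lipschitz_convex D g, forall x u, D (col_mx x u) <-> controlU Q t w x u
    & forall x u, (cost Q t w x u +
                   pinfty_ext (stateX Q t.+1) f (dynamics Q t w x u))%dE =
        pinfty_ext D g (col_mx x u)].
Proof.
move=> tT wS lcf; have [c lcc cE] := cost_pinfty_ext tT wS.
pose M := row_mx (lp_A Q t w) (lp_B Q t w).
have dynE x u : dynamics Q t w x u = M *m col_mx x u by rewrite mul_row_col.
exists (lp_P Q t w `&` (mulmx M @^-1` stateX Q t.+1)).
exists (fun z => c z + f (M *m z)).
split=> [|x u|x u].
- exact/lipschitz_convexD/lipschitz_convex_preimage.
- by rewrite /controlU /= cost_lty// dynE.
- by rewrite cE dynE -pinfty_extD.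
Qed.

Lemma bellman_w_pinfty_ext t w f x : (t < T)%N -> lp_supp Q t w ->
  lipschitz_convex (stateX Q t.+1) f ->
  controlU Q t w x !=set0 -> compact (controlU Q t w x) ->
  exists2 g, lipschitz_convex (control_dom t w) g &
    bellman_w Q t w (pinfty_ext (stateX Q t.+1) f) =
    pinfty_ext (control_dom t w) g.
Proof.
move=> tT wS lcf [u0 Uu0] /compact_enorm_bounded[M UM].
have [D [g [lcg DU costE]]] := stage_cost_pinfty_ext tT wS lcf.
have domE : control_dom t w = [set y | exists u, D (col_mx y u)].
  by apply/seteqP; split=> y [u] /DU Du; exists u.
have [_ _ [K K0 lipg]] := lcg.
have [||h lch infE] := lipschitz_convex_inf_projection (y0 := x) lcg.
- by exists u0; apply/DU.
- have [||l l_lb] := @lip_on_has_lbound _ _ _ _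
      [set col_mx x u | u in [set u | D (col_mx x u)]] _ K0 lipg.
  + by move=> _ [u Du <-].
  + exists (enorm x + M) => _ [u /DU /UM uM <-].
    by apply: le_trans (ler_enorm_col_mx _ _) _; rewrite lerD2l.
  + exists l => _ [u Du <-].
    by apply: l_lb; exists (col_mx x u) => //; exists u.
rewrite domE; exists h => //; apply/funext => y; rewrite -infE.
rewrite /bellman_w; congr (ereal_inf (image _ _)).
by apply/funext => u; exact: costE.
Qed.

Lemma stateX_control_dom t : (t < T)%N ->
  (forall w x, lp_supp Q t w -> stateX Q t x -> controlU Q t w x !=set0) ->
  stateX Q t = \big[setI/setT]_(w <- supp t) control_dom t w.
Proof.
move=> tT U0; rewrite -bigcap_seq; apply/seteqP; split=> x Xx.
  by move=> w /= /(suppP _ tT) wS; exact: U0.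
rewrite /stateX tT => w wS; have [|u [cost_lty _]] := Xx w; first exact/suppP.
by exists u.
Qed.

Lemma bellman_pinfty_ext t f : (t < T)%N -> stateX Q t !=set0 ->
  (forall w x, lp_supp Q t w -> stateX Q t x ->
     controlU Q t w x !=set0 /\ compact (controlU Q t w x)) ->
  lipschitz_convex (stateX Q t.+1) f ->
  let phi := pinfty_ext (stateX Q t.+1) f in
  exists2 g : TW -> 'cV[R]_n -> R,
    forall w, lp_supp Q t w -> lipschitz_convex (control_dom t w) (g w) /\
      bellman_w Q t w phi = pinfty_ext (control_dom t w) (g w)
    & bellman Q t phi = pinfty_ext (stateX Q t)
        (fun y => \sum_(w <- supp t) lp_p Q t w * g w y).
Proof.
move=> tT [x Xx] hU lcf phi.
have /choice[g gP] w : exists g, lp_supp Q t w ->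
    lipschitz_convex (control_dom t w) g /\
    bellman_w Q t w phi = pinfty_ext (control_dom t w) g.
  have [wS|nwS] := pselect (lp_supp Q t w); last by exists (fun=> 0).
  have [U0 Ucompact] := hU w x wS Xx.
  by have [g lcg gE] := bellman_w_pinfty_ext tT wS lcf U0 Ucompact; exists g.
exists g => //; apply/funext => y.
rewrite (stateX_control_dom tT (fun w x wS Xx => (hU w x wS Xx).1)).
rewrite -dsum_pinfty_ext => [|w /(suppP _ tT)]; last exact: lp_p_gt0.
rewrite /bellman fsbig_supp//.
by apply: eq_big_seq => w /(suppP _ tT)/gP[_ ->].
Qed.

Lemma bellman_subgradients t f L x : (t < T)%N -> 0 <= L ->
  (forall w x, lp_supp Q t w -> stateX Q t x ->
     controlU Q t w x !=set0 /\ compact (controlU Q t w x)) ->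
  lipschitz_convex (stateX Q t.+1) f ->
  let phi := pinfty_ext (stateX Q t.+1) f in
  Defs.lipschitz_on L (stateX Q t) (bellman Q t phi) -> stateX Q t x ->
  exists2 a : TW -> 'cV[R]_n,
    forall w, lp_supp Q t w -> subgradient (bellman_w Q t w phi) x (a w)
    & enorm (\sum_(w \in lp_supp Q t) lp_p Q t w *: a w) <= L.
Proof.
move=> tT L0 hU lcf phi lipB Xx.
have [|g gP bellmanE] := bellman_pinfty_ext tT _ hU lcf; first by exists x.
have lcpg w : w \in supp t ->
    lipschitz_convex (control_dom t w) (fun y => lp_p Q t w * g w y).
  move=> /(suppP _ tT) wS; apply: lipschitz_convexZ; last by have [] := gP w wS.
  by rewrite ltW// lp_p_gt0.
have XE := stateX_control_dom tT (fun w x wS Xx => (hU w x wS Xx).1).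
have domx w : w \in supp t -> control_dom t w x.
  by move: Xx; rewrite XE -bigcap_seq; exact.
move: lipB Xx; rewrite bellmanE XE => /lipschitz_on_pinfty_ext lipB Xx.
have [hX convB _] := lipschitz_convex_bigsum lcpg.
have [a aL asub] := calm_subgradient L0 (polyhedron_convex hX) convB
  (fun y Xy => lipB y x Xy Xx).
have [b aE bsub] := subgradient_on_bigsum (fset_uniq _) lcpg domx asub.
exists (fun w => (lp_p Q t w)^-1 *: b w) => [w wS|].
  have [_ ->] := gP w wS; have ws := (suppP w tT).2 wS.
  apply: subgradient_pinfty_ext; first exact: domx.
  exact: subgradient_onZ (lp_p_gt0 wS) (bsub w ws).
rewrite fsbig_supp// (eq_big_seq b) -?aE// => w /(suppP _ tT)/lp_p_gt0 pw.
by rewrite scalerA mulfV ?scale1r// gt_eqF.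
Qed.

Lemma final_cost_subgradient L x : 0 <= L ->
  Defs.lipschitz_on L (stateX Q T) (final_cost Q) -> stateX Q T x ->
  exists2 a, subgradient (final_cost Q) x a & enorm a <= L.
Proof.
have [g [hX convg _] ->] := final_cost_pinfty_ext.
rewrite stateX_final => L0 /lipschitz_on_pinfty_ext lipg Xx.
have [a aL asub] := calm_subgradient L0 (polyhedron_convex hX) convg
  (fun y Xy => lipg y x Xy Xx).
by exists a => //; exact: subgradient_pinfty_ext.
Qed.

End BellmanOperator.

Section SDDPCuts.
Context (R : realType) (d : measure_display) (Omega : measurableType d)
  (Pr : probability Omega R) (dW : measure_display) (TW : measurableType dW)
  (n m : nat) (Q : lp_problem Pr TW n m) (L : nat -> R).
Hypotheses (measurable_sing : forall w : TW, measurable [set w])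
  (Q_lp : linear_polyhedral Q)
  (fin_noise : forall t, (1 <= t <= lp_T Q)%N -> finitely_supported (lp_W Q t))
  (compact_controls : forall t w x, (t < lp_T Q)%N -> lp_supp Q t w ->
     stateX Q t x -> controlU Q t w x !=set0 /\ compact (controlU Q t w x))
  (L_lip : lipschitz_constants Q L).

Local Notation T := (lp_T Q).

Lemma L_ge0 t : (t <= T)%N -> 0 <= L t.
Proof. by have [L0 _ _] := L_lip; move=> /L0/ltW. Qed.

Lemma admissible_pinfty_ext t F : (t < T)%N -> admissible Q L t F ->
  exists phi, [/\ lipschitz_convex (stateX Q t.+1) phi,
    lip_on (L t.+1) (stateX Q t.+1) phi
    & sup_of F = pinfty_ext (stateX Q t.+1) phi].
Proof.
move=> tT [Fbasic F0 Fy]; apply: sup_of_affine_pinfty_ext => //.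
  exact: L_ge0.
exact: stateX_polyhedron.
Qed.

Lemma bellman_admissible_lipschitz t F : (t < T)%N -> admissible Q L t F ->
  Defs.lipschitz_on (L t) (stateX Q t) (bellman Q t (sup_of F)).
Proof.
move=> tT /(admissible_pinfty_ext tT)[phi [_ lipphi ->]].
have [_ _ lipB] := L_lip; apply: lipB => // [x nXx|].
  exact: pinfty_ext_out.
exact/lipschitz_on_pinfty_ext.
Qed.

Lemma cut_basic t a x b : enorm a <= L t -> basic Q L t (Defs.cut Q t a x b).
Proof.
move=> aL; exists a, (b - dotv a x); split=> //.
by apply/funext => y; rewrite /Defs.cut dotvBr addrAC addrA.
Qed.

Lemma cut_in t a x b y : stateX Q t y ->
  Defs.cut Q t a x b y = (b + dotv a (y - x))%:E.
Proof. by move=> Xy; rewrite addrC; exact: pinfty_ext_in. Qed.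

Lemma cut_at t a x b : stateX Q t x -> Defs.cut Q t a x b x = b%:E.
Proof. by move=> Xx; rewrite cut_in// subrr dotv0r addr0. Qed.

Lemma sddp_cut_minorant t F x (a : TW -> 'cV[R]_n) (b : TW -> R) y :
  (t < T)%N ->
  (forall w, lp_supp Q t w -> bellman_w Q t w (sup_of F) x = (b w)%:E /\
     subgradient (bellman_w Q t w (sup_of F)) x (a w)) ->
  ((\sum_(w \in lp_supp Q t) lp_p Q t w * b w +
    dotv (\sum_(w \in lp_supp Q t) lp_p Q t w *: a w) (y - x))%:E
     <= bellman Q t (sup_of F) y)%E.
Proof.
move=> tT ab.
have -> : \sum_(w \in lp_supp Q t) lp_p Q t w * b w +
    dotv (\sum_(w \in lp_supp Q t) lp_p Q t w *: a w) (y - x) =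
    \sum_(w \in lp_supp Q t) lp_p Q t w * (b w + dotv (a w) (y - x)).
  rewrite !(fsbig_supp fin_noise)// dotv_suml -big_split.
  by apply: eq_bigr => w _ /=; rewrite dotvZl mulrDr.
apply: bellman_ge => // w wS; have [bw [_ aw]] := ab w wS.
by rewrite EFinD -bw.
Qed.

Lemma sddp_cut_tight_valid t F x g : (t < T)%N -> stateX Q t x ->
  sddp_cut Q t F x g ->
  g x = bellman Q t (sup_of F) x /\
  forall y, (g y <= bellman Q t (sup_of F) y)%E.
Proof.
move=> tT Xx [a [b [ab ->]]]; split=> [|y].
  by rewrite cut_at// (bellman_eq fin_noise tT (fun w wS => (ab w wS).1)).
have [Xy|nXy] := pselect (stateX Q t y).
  by rewrite cut_in//; exact: sddp_cut_minorant.
by rewrite (bellman_outside measurable_sing)// leey.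
Qed.

Lemma sddp_cut_basic_interior t F x g : (t < T)%N -> admissible Q L t F ->
  interior (stateX Q t) x -> sddp_cut Q t F x g -> basic Q L t g.
Proof.
move=> tT aF Xx [a [b [ab ->]]]; apply: cut_basic.
apply: interior_subgradient_le (bellman_admissible_lipschitz tT aF) Xx _.
  exact/L_ge0/ltnW.
move=> y _; rewrite (bellman_eq fin_noise tT (fun w wS => (ab w wS).1)) -EFinD.
exact: sddp_cut_minorant.
Qed.

Lemma sddp_cut_exists t F x : (t < T)%N -> admissible Q L t F -> stateX Q t x ->
  exists g, sddp_cut Q t F x g /\ basic Q L t g.
Proof.
move=> tT aF Xx; have [phi [lcphi _ phiE]] := admissible_pinfty_ext tT aF.
have := bellman_admissible_lipschitz tT aF; rewrite phiE => lipB.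
have [||a asub aL] :=
    bellman_subgradients measurable_sing Q_lp fin_noise tT _ _ lcphi lipB Xx.
- exact/L_ge0/ltnW.
- by move=> w y; exact: compact_controls.
pose b w := fine (bellman_w Q t w (sup_of F) x).
exists (Defs.cut Q t (\sum_(w \in lp_supp Q t) lp_p Q t w *: a w) x
  (\sum_(w \in lp_supp Q t) lp_p Q t w * b w)); split; last exact: cut_basic.
exists a, b; split=> // w /asub aw; rewrite /b phiE; split=> //.
by rewrite fineK//; case: aw.
Qed.

Lemma sddp_map_selection_exists t : (t < T)%N ->
  exists S, sddp_map Q L t S /\ selection Q L t S.
Proof.
move=> tT.
pose S F x := xget (fun=> 0%E) [set g | sddp_cut Q t F x g /\ basic Q L t g].
have SP F x : admissible Q L t F -> stateX Q t x ->
    sddp_cut Q t F x (S F x) /\ basic Q L t (S F x).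
  by move=> aF Xx; have := xgetPex (fun=> 0%E) (sddp_cut_exists tT aF Xx).
exists S; split=> [F x aF Xx|]; first by have [] := SP F x aF Xx.
split=> F x aF Xx; have [SFx Sbasic] := SP F x aF Xx; first exact: Sbasic.
exact: sddp_cut_tight_valid SFx.
Qed.

Lemma sddp_cutT_tight_valid x g : stateX Q T x -> sddp_cutT Q x g ->
  g x = value Q T x /\ forall y, (g y <= value Q T y)%E.
Proof.
rewrite /value subnn /= => Xx [a [b [[_ asub] fx ->]]].
split=> [|y]; first by rewrite cut_at.
have [Xy|nXy] := pselect (stateX Q T y); first by rewrite cut_in// EFinD -fx.
move: nXy; rewrite /stateX ltnn /edom /= => /negP; rewrite -leNgt.
by apply: le_trans; exact: leey.
Qed.

Lemma sddp_cutT_basic_interior x g :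
  interior (stateX Q T) x -> sddp_cutT Q x g -> basic Q L T g.
Proof.
move=> Xx [a [b [[_ asub] _ ->]]]; have [_ lipT _] := L_lip; apply: cut_basic.
apply: interior_subgradient_le lipT Xx _ => [|y _]; first exact: L_ge0.
exact: asub.
Qed.

Lemma sddp_cutT_exists x : stateX Q T x ->
  exists g, sddp_cutT Q x g /\ basic Q L T g.
Proof.
move=> Xx; have [_ lipT _] := L_lip.
have [a asub aL] := final_cost_subgradient Q_lp (L_ge0 (leqnn _)) lipT Xx.
exists (Defs.cut Q T a x (fine (final_cost Q x))); split; last exact: cut_basic.
by exists a, (fine (final_cost Q x)); split; rewrite ?fineK//; case: asub.
Qed.

Lemma sddp_mapT_selection_exists : exists S, sddp_mapT Q S /\ selectionT Q L S.
Proof.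
pose S x := xget (fun=> 0%E) [set g | sddp_cutT Q x g /\ basic Q L T g].
have SP x : stateX Q T x -> sddp_cutT Q x (S x) /\ basic Q L T (S x).
  by move=> Xx; have := xgetPex (fun=> 0%E) (sddp_cutT_exists Xx).
exists S; split=> [x /SP[]//|]; split=> [x /SP[]//|x Xx].
by apply: sddp_cutT_tight_valid => //; have [] := SP x Xx.
Qed.

End SDDPCuts.

Theorem proposition14 (R : realType) (d : measure_display)
  (Omega : measurableType d) (Pr : probability Omega R)
  (dW : measure_display) (TW : measurableType dW)
  (n m : nat) (Q : lp_problem Pr TW n m) (L : nat -> R)
  (hTW : forall w : TW, measurable [set w])
  (hQ : linear_polyhedral Q)
  (hsupp : forall t : nat, (1 <= t <= lp_T Q)%N ->
     finitely_supported (lp_W Q t))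
  (hindep : independent_noises (lp_T Q) (lp_W Q))
  (hX : forall t : nat, (t <= lp_T Q)%N ->
     stateX Q t !=set0 /\ compact (stateX Q t))
  (hU : forall (t : nat) (w : TW) (x : 'cV[R]_n), (t < lp_T Q)%N ->
     lp_supp Q t w -> stateX Q t x ->
     controlU Q t w x !=set0 /\ compact (controlU Q t w x))
  (hL : lipschitz_constants Q L) :
  [/\ (* t = T *)
      (forall S, sddp_mapT Q S ->
         tight_validT Q S /\
         forall x : 'cV[R]_n, interior (stateX Q (lp_T Q)) x ->
           basic Q L (lp_T Q) (S x)),
      (exists S, sddp_mapT Q S /\ selectionT Q L S)
    & (* t < T *)
      forall t : nat, (t < lp_T Q)%N ->
        (forall S, sddp_map Q L t S ->
           tight_valid Q L t S /\
           forall (F : set ('cV[R]_n -> \bar R)) (x : 'cV[R]_n),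
             admissible Q L t F -> interior (stateX Q t) x ->
             basic Q L t (S F x)) /\
        (exists S, sddp_map Q L t S /\ selection Q L t S)].
Proof.
split=> [S hS||t tT].
- split=> x Xx; first by apply: sddp_cutT_tight_valid => //; exact: hS.
  by apply: (sddp_cutT_basic_interior hL Xx); apply: hS; exact: interior_subset.
- exact: (sddp_mapT_selection_exists hQ hL).
split=> [S hS|]; last exact: (sddp_map_selection_exists hTW hQ hsupp hU hL tT).
split=> F x aF Xx; first by apply: sddp_cut_tight_valid => //; exact: hS.
apply: (sddp_cut_basic_interior hTW hQ hsupp hL tT aF Xx).
by apply: hS => //; exact: interior_subset.
Qed.
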